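(* Let $(M,J)$ be a compact complex manifold of complex dimension $n\geq 3$. If $g$ is a $J$-Hermitian metric on $M$ which is $1$-st Gauduchon and balanced, then $g$ is Kähler.
   Context: For a $J$-Hermitian metric $g$ on a complex manifold $(M,J)$ of complex dimension $n$, the fundamental $2$-form is $\Omega(\cdot,\cdot)=g(J\cdot,\cdot)$. The metric $g$ is $1$-st Gauduchon if $\partial\overline{\partial}\Omega\wedge\Omega^{n-2}=0$. The Lee form is the $1$-form $\theta=Jd^*\Omega$, where $d^*$ is the formal adjoint of $d$ with respect to $g$; it satisfies $d(\Omega^{n-1})=\theta\wedge\Omega^{n-1}$. The Hermitian structure is balanced if $\theta=0$, equivalently $d(\Omega^{n-1})=0$. The metric is Kähler if $d\Omega=0$. *)

(* Defs.v *)
From HB Require Import structures.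
From mathcomp Require Import all_boot all_order all_algebra.
From mathcomp Require Import complex.
From mathcomp Require Import all_classical all_reals all_analysis.

Set Implicit Arguments.
Unset Strict Implicit.
Unset Printing Implicit Defensive.

Import Order.TTheory GRing.Theory Num.Theory.
Import numFieldNormedType.Exports.

Local Open Scope classical_set_scope.
Local Open Scope complex_scope.
Local Open Scope ring_scope.

(** * The exterior algebra on an ordered coframe e_0, ..., e_(m-1)

    An element is its family of coefficients: [alpha I] is the coefficient of
    e_I := e_{i_1} /\ ... /\ e_{i_p}, where I = {i_1 < ... < i_p}. *)

Notation ext K m := {ffun {set 'I_m} -> K^o}.

Section Exterior.
Variables (K : fieldType) (m : nat).
Implicit Types (I L S : {set 'I_m}) (A : 'M[K]_m).

Implicit Types alpha beta : ext K m.

Definition ext_basis I : ext K m := [ffun S : {set 'I_m} => (S == I)%:R].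

(* e_I /\ e_L = sgn I L e_(I u L) when I and L are disjoint *)
Definition sgn I L : K :=
  (-1) ^+ #|[set p in finset.setX I L | (p.2 < p.1)%N]%SET|.

Definition wedge alpha beta : ext K m :=
  [ffun S : {set 'I_m} => \sum_(I : {set 'I_m} | (I \subset S)%B)
     sgn I (S :\: I)%SET * alpha I * beta (S :\: I)%SET].

Definition wedge_pow alpha (k : nat) : ext K m := iter k (wedge alpha) (ext_basis finset.set0).

(* the interior product with the a-th vector of the dual frame *)
Definition contract (a : 'I_m) alpha : ext K m :=
  [ffun S : {set 'I_m} =>
     if a \in S then 0 else sgn [set a]%SET S * alpha (a |: S)%SET].

(* the algebra endomorphism sending e_i to \sum_j A i j e_j *)
Definition ext_lin A alpha : ext K m :=
  \sum_(S : {set 'I_m})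
    alpha S *: \big[wedge/ext_basis finset.set0]_(i in S)
                 (\sum_j A i j *: ext_basis [set j]%SET).

End Exterior.

(** * Complex-valued forms on open subsets of C^n

    C^n is R^(n+n) with coordinates (x_1, ..., x_n, y_1, ..., y_n).  Forms are
    written in the coframe (dz_1, ..., dz_n, dzb_1, ..., dzb_n), so that the
    indices [lshift n j] and [rshift n j] stand for dz_j and dzb_j. *)

Section Forms.
Variables (R : realType) (n : nat).

Notation E := 'rV[R]_(n + n).
Notation C := R[i].
Notation extC := (ext C (n + n)).

(* v *m Jmx is J v:  J d/dx_j = d/dy_j and J d/dy_j = - d/dx_j *)
Definition Jmx : 'M[R]_(n + n) := block_mx 0 1%:M (- 1%:M) 0.

(* its rows are the frame d/dz_j = (d/dx_j - i d/dy_j)/2,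
   d/dzb_j = (d/dx_j + i d/dy_j)/2 dual to (dz, dzb) *)
Definition frame : 'M[C]_(n + n) :=
  block_mx (2^-1)%:M (- ('i%C / 2))%:M
           (2^-1)%:M ('i%C / 2)%:M.

(* directional derivative of a complex-valued function *)
Definition cderive (v : E) (f : E -> C) (x : E) : C :=
  ('D_v (fun y => complex.Re (f y)) x) +i* ('D_v (fun y => complex.Im (f y)) x).

(* coefficientwise derivative of a form along the a-th vector of [frame] *)
Definition fderive (a : 'I_(n + n)) (alpha : E -> extC) (x : E) : extC :=
  [ffun S : {set 'I_(n + n)} =>
     \sum_b frame a b * cderive (delta_mx 0 b) (fun y => alpha y S) x].

Definition del (alpha : E -> extC) (x : E) : extC :=
  \sum_(j < n) wedge (ext_basis C [set lshift n j]%SET) (fderive (lshift n j) alpha x).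

Definition delbar (alpha : E -> extC) (x : E) : extC :=
  \sum_(j < n) wedge (ext_basis C [set rshift n j]%SET) (fderive (rshift n j) alpha x).

Definition extd (alpha : E -> extC) (x : E) : extC :=
  \sum_(a < n + n) wedge (ext_basis C [set a]%SET) (fderive a alpha x).

(* the action of J, (J alpha)(X) = - alpha (J X) on 1-forms, extended as an
   algebra morphism:  J dz_j = - i dz_j,  J dzb_j = i dzb_j *)
Definition Jform (alpha : extC) : extC :=
  ext_lin (block_mx (- 'i%C)%:M 0 0 ('i%C)%:M) alpha.

(** ** Hermitian metrics

    A Riemannian metric is given by its Gram matrix in the coordinates (x, y):
    g (u, v) = u *m G *m v^T. *)

Fixpoint Ck_on (k : nat) (V : set E) (f : E -> R) : Prop :=
  match k with
  | 0%N => forall x, V x -> {for x, continuous f}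
  | k'.+1 => forall v : E,
      (forall x, V x -> derivable f x v) /\ Ck_on k' V ('D_v f)
  end.

Definition smooth_on (V : set E) (f : E -> R) : Prop := forall k, Ck_on k V f.

Definition hermitian_gram (G : 'M[R]_(n + n)) : Prop :=
  [/\ G^T = G,
      forall v : E, v != 0 -> 0 < (v *m G *m v^T) 0 0 &
      forall u v : E,
        ((u *m Jmx) *m G *m (v *m Jmx)^T) 0 0 = (u *m G *m v^T) 0 0].

(* the matrix in [frame] of the C-bilinear extension of a real bilinear form *)
Definition frame_gram (B : 'M[R]_(n + n)) : 'M[C]_(n + n) :=
  frame *m map_mx (real_complex R) B *m frame^T.

(* Omega (u, v) = g (J u, v) *)
Definition fund_form (G : E -> 'M[R]_(n + n)) (x : E) : extC :=
  \sum_(a < n + n) \sum_(b < n + n | (a < b)%N)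
    frame_gram (Jmx *m G x) a b *: ext_basis C [set a; b]%SET.

(* The formal adjoint of d, extended C-linearly.  Integrating
   <d eta, alpha> sqrt(det G) by parts in coordinates gives the formula
     (d^* alpha)^(I) = - (det G)^(-1/2) \sum_a d_a ((det G)^(1/2) alpha^(a I)),
   i.e. d^* alpha_(I) = - nabla^a alpha_(a I); indices are raised and lowered by
   means of g. It holds in [frame] since this has constant coefficients. *)
Definition vol_density (G : E -> 'M[R]_(n + n)) (x : E) : C :=
  (Num.sqrt (\det (G x)))%:C.

Definition raise (G : E -> 'M[R]_(n + n)) (alpha : E -> extC) (x : E) : extC :=
  ext_lin (invmx (frame_gram (G x))) (alpha x).

Definition lower (G : E -> 'M[R]_(n + n)) (alpha : E -> extC) (x : E) : extC :=
  ext_lin (frame_gram (G x)) (alpha x).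

Definition codiff (G : E -> 'M[R]_(n + n)) (alpha : E -> extC) : E -> extC :=
  lower G (fun x => - (vol_density G x)^-1 *:
    \sum_a contract a (fderive a (fun y => vol_density G y *: raise G alpha y) x)).

Definition lee_form (G : E -> 'M[R]_(n + n)) (x : E) : extC :=
  Jform (codiff G (fund_form G) x).

End Forms.

(** * Complex manifolds

    [param i] is the inverse of the chart [chart i]; both are total functions
    that are meaningful only on [dom i] and on its image.  A holomorphic map is a
    differentiable one whose differential is C-linear, i.e. commutes with J.  The
    differential is v |-> v *m jacobian. *)

Record complex_atlas (R : realType) (n : nat) (M : topologicalType) := ComplexAtlas {
  atlas_ix : Type;
  dom : atlas_ix -> set M;
  chart : atlas_ix -> M -> 'rV[R]_(n + n);
  param : atlas_ix -> 'rV[R]_(n + n) -> M;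
  dom_open : forall i, open (dom i);
  codom_open : forall i, open (chart i @` dom i);
  dom_cover : forall p, exists i, dom i p;
  chartK : forall i p, dom i p -> param i (chart i p) = p;
  chart_continuous : forall i p, dom i p -> {for p, continuous (chart i)};
  param_continuous : forall i x, (chart i @` dom i) x -> {for x, continuous (param i)};
  transition_holomorphic : forall i j p, dom i p -> dom j p ->
    let tau := chart j \o param i in
    differentiable tau (chart i p) /\
    jacobian tau (chart i p) *m Jmx R n = Jmx R n *m jacobian tau (chart i p)
}.

Section Manifold.
Variables (R : realType) (n : nat) (M : topologicalType).
Variable X : complex_atlas R n M.

Definition codom (i : atlas_ix X) : set 'rV[R]_(n + n) := chart i @` dom i.

(* a metric is given by its Gram matrices in all the charts *)
Record hermitian_metric := HermitianMetric {
  gram : atlas_ix X -> 'rV[R]_(n + n) -> 'M[R]_(n + n);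
  gram_smooth : forall i a b, smooth_on (codom i) (fun x => gram i x a b);
  gram_hermitian : forall i x, codom i x -> hermitian_gram (gram i x);
  gram_change : forall i j p, dom i p -> dom j p ->
    let D := jacobian (chart j \o param i) (chart i p) in
    gram i (chart i p) = D *m gram j (chart j p) *m D^T
}.

Implicit Type g : hermitian_metric.

Definition first_gauduchon g : Prop :=
  forall i x, codom i x ->
    wedge (del (delbar (fund_form (gram g i))) x)
          (wedge_pow (fund_form (gram g i) x) (n - 2)) = 0.

Definition balanced g : Prop :=
  forall i x, codom i x -> lee_form (gram g i) x = 0.

Definition kahler g : Prop :=
  forall i x, codom i x -> extd (fund_form (gram g i)) x = 0.

End Manifold.

(* Main.v *)
Require Import Defs.
From HB Require Import structures.
From mathcomp Require Import all_boot all_order all_algebra.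
From mathcomp Require Import all_classical all_reals all_analysis.
From mathcomp Require Import complex spectral ring zify.
Import Defs.

(** The argument is local: in a chart, the two conditions force the torsion of the
    metric to vanish at each point.

    Write h_jl for the matrix of g on (1,0) x (0,1) vectors, q for its inverse,
    with \sum_l h_il q_jl = delta_ij, and
    S_klj = dbar_k h_jl - dbar_l h_jk for the coefficients of dbar Omega.

    - Being balanced says that the trace \sum_jl q_jl S_klj vanishes identically
      ([lee_form_trace]).  Indeed d^* Omega is a divergence, that of the bivector
      obtained by raising the indices of Omega, which is -i q_jl up to order;
      Jacobi's formula differentiates the volume density.

    - Being 1-st Gauduchon says that \sum q_ik q_jl d_i S_klj = 0
      ([gauduchon_trace]).  This rests on a formula for e_a e_b e_c e_d Omega^(n-2)
      as a multiple of Omega^n ([wedge4_pow]), obtained by contracting forms of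
      degree 2n+1, which are zero, and on Omega^n <> 0 ([pow_top_neq0]).

    - Differentiating the first identity along d_i and contracting with q_ik turns
      the second one into
        \sum q_ik q_al q_jb S_klj d_i h_ab = 0.
      As S is antisymmetric in k, l, the factor d_i h_ab may be replaced by
      T_iab = d_i h_ab - d_a h_ib, and S_klj is the conjugate of T_klj.  So the
      squared norm of T is zero, hence T = 0 ([torsion_eq0]), by positivity of q
      ([posdef_tensor]).

    Both T and its conjugate S being zero, d Omega = 0 ([local_kahler]). *)

Set Implicit Arguments.
Unset Strict Implicit.
Unset Printing Implicit Defensive.

Import Order.TTheory GRing.Theory Num.Theory.
Import numFieldNormedType.Exports.

Local Open Scope ring_scope.

(** * Wedge and interior products *)

Section Wedge.
Variables (K : fieldType) (m : nat).
Implicit Types (I J L S : {set 'I_m}) (a b c : 'I_m) (alpha beta gamma : ext K m).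

Notation "1^" := (ext_basis K (finset.set0 : {set 'I_m})).
Notation e_ a := (ext_basis K [set a]%SET).

Lemma sgn_setUl I J L : [disjoint I & J] ->
  sgn K (I :|: J)%SET L = sgn K I L * sgn K J L.
Proof.
move=> dIJ; rewrite /sgn -exprD; congr (_ ^+ _).
rewrite -cardsUI; set A := (X in (_ + #|pred_of_set X|)%N).
have -> : A = finset.set0.
  apply/setP => p; rewrite !inE; apply/negP => /and3P[].
  move=> /andP[/andP[pI _] _] /andP[pJ _] _.
  by move/pred0P: dIJ => /(_ p.1); rewrite /= pI pJ.
rewrite cards0 addn0; congr (#|pred_of_set _|).
by apply/setP => p; rewrite !inE -!andb_orl.
Qed.

Lemma sgn_setUr I J L : [disjoint J & L] ->
  sgn K I (J :|: L)%SET = sgn K I J * sgn K I L.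
Proof.
move=> dJL; rewrite /sgn -exprD; congr (_ ^+ _).
rewrite -cardsUI; set A := (X in (_ + #|pred_of_set X|)%N).
have -> : A = finset.set0.
  apply/setP => p; rewrite !inE; apply/negP => /and3P[].
  move=> /andP[/andP[_ pJ] _] /andP[_ pL] _.
  by move/pred0P: dJL => /(_ p.2); rewrite /= pJ pL.
rewrite cards0 addn0; congr (#|pred_of_set _|).
apply/setP => p; rewrite !inE -!andb_orl; congr andb.
by rewrite andb_orr.
Qed.

Lemma sgn11 a b : sgn K [set a]%SET [set b]%SET = (-1) ^+ (b < a)%N.
Proof.
rewrite /sgn; congr (_ ^+ _); case: ltnP => ba.
  (* the only candidate for an inversion is the pair (a, b) itself *)
  rewrite [X in pred_of_set X](_ : _ = [set (a, b)]%SET) ?cards1//.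
  apply/setP => -[x y]; rewrite !inE /=.
  by apply/andP/eqP => [[/andP[/eqP -> /eqP ->]]|[-> ->]]; rewrite ?eqxx.
rewrite [X in pred_of_set X](_ : _ = finset.set0) ?cards0//.
apply/setP => -[x y]; rewrite !inE /=.
by apply/negP => /andP[/andP[/eqP -> /eqP ->]]; rewrite ltnNge ba.
Qed.

Lemma sgn11N a b : a != b ->
  sgn K [set a]%SET [set b]%SET = - sgn K [set b]%SET [set a]%SET.
Proof.
move=> ab; rewrite !sgn11.
case: ltngtP => [_|_|/val_inj ba]; rewrite ?expr0 ?expr1 ?opprK//.
by rewrite ba eqxx in ab.
Qed.

Lemma wedgeDl alpha beta gamma :
  wedge (alpha + beta) gamma = wedge alpha gamma + wedge beta gamma.
Proof.
apply/ffunP => S; rewrite !ffunE -big_split; apply: eq_bigr => I _.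
by rewrite ffunE mulrDr mulrDl.
Qed.

Lemma wedgeDr alpha beta gamma :
  wedge alpha (beta + gamma) = wedge alpha beta + wedge alpha gamma.
Proof.
apply/ffunP => S; rewrite !ffunE -big_split; apply: eq_bigr => I _.
by rewrite ffunE mulrDr.
Qed.

Lemma wedgeZl k alpha beta : wedge (k *: alpha) beta = k *: wedge alpha beta.
Proof.
apply/ffunP => S; rewrite !ffunE scaler_sumr; apply: eq_bigr => I _.
by rewrite ffunE /GRing.scale /= (mulrCA _ k) !mulrA.
Qed.

Lemma wedgeZr k alpha beta : wedge alpha (k *: beta) = k *: wedge alpha beta.
Proof.
apply/ffunP => S; rewrite !ffunE scaler_sumr; apply: eq_bigr => I _.
by rewrite ffunE /GRing.scale /= mulrCA.
Qed.

Lemma wedge0r alpha : wedge alpha 0 = 0.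
Proof. by rewrite -(scale0r (0 : ext K m)) wedgeZr !scale0r. Qed.

Lemma wedge0l alpha : wedge 0 alpha = 0.
Proof. by rewrite -(scale0r (0 : ext K m)) wedgeZl !scale0r. Qed.

Lemma wedgeNr alpha beta : wedge alpha (- beta) = - wedge alpha beta.
Proof. by rewrite -scaleN1r wedgeZr scaleN1r. Qed.

Lemma wedgeNl alpha beta : wedge (- alpha) beta = - wedge alpha beta.
Proof. by rewrite -scaleN1r wedgeZl scaleN1r. Qed.

Lemma wedge_suml (T : Type) (r : seq T) (P : pred T) (F : T -> ext K m) beta :
  wedge (\sum_(i <- r | P i) F i) beta = \sum_(i <- r | P i) wedge (F i) beta.
Proof.
by elim/big_rec2: _ => [|i y x _ <-]; rewrite ?wedge0l// wedgeDl.
Qed.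

Lemma wedge_sumr (T : Type) (r : seq T) (P : pred T) (F : T -> ext K m) beta :
  wedge beta (\sum_(i <- r | P i) F i) = \sum_(i <- r | P i) wedge beta (F i).
Proof.
by elim/big_rec2: _ => [|i y x _ <-]; rewrite ?wedge0r// wedgeDr.
Qed.

Lemma ext_basis_sum alpha : alpha = \sum_S alpha S *: ext_basis K S.
Proof.
apply/ffunP => S; rewrite sum_ffunE (bigD1 S)//= !ffunE eqxx.
rewrite /GRing.scale /= mulr1 big1 ?addr0// => I IS.
by rewrite !ffunE eq_sym (negPf IS) /GRing.scale /= mulr0.
Qed.

Lemma wedge_basis I L : wedge (ext_basis K I) (ext_basis K L) =
  if [disjoint I & L] then sgn K I L *: ext_basis K (I :|: L)%SET else 0.
Proof.
apply/ffunP => S; rewrite ffunE.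
have -> : \sum_(J : {set 'I_m} | J \subset S) sgn K J (S :\: J)%SET *
      ext_basis K I J * ext_basis K L (S :\: J)%SET =
    if (I \subset S) && ((S :\: I)%SET == L) then sgn K I L else 0.
  case: ifP => [/andP[IS /eqP SI]|IS].
    rewrite (bigD1 I)//= !ffunE SI !eqxx !mulr1 big1 ?addr0// => J /andP[_ JI].
    by rewrite !ffunE (negPf JI) mulr0 mul0r.
  apply: big1 => J JS; rewrite !ffunE; case: eqP => [JI|]; last by rewrite mulr0 mul0r.
  by move: IS; rewrite -JI JS /= => ->; rewrite mulr0.
have -> : (I \subset S) && ((S :\: I)%SET == L) =
    [disjoint I & L] && (S == I :|: L)%SET.
  apply/andP/andP => [[IS /eqP <-]|[dIL /eqP ->]]; split.
  - by rewrite disjoint_sym finset.disjoints_subset; apply/fintype.subsetP => x; rewrite !inE => /andP[].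
  - by rewrite -[X in (X :|: _)%SET](finset.setIidPr IS) finset.setID.
  - exact: finset.subsetUl.
  - rewrite finset.setDUl finset.setDv finset.set0U; apply/eqP/finset.setDidPl.
    by rewrite disjoint_sym.
case: [disjoint I & L]; rewrite ?ffunE//=.
by case: (S == _); rewrite /GRing.scale /= ?mulr1 ?mulr0.
Qed.

Lemma disjointsUl (I J L : {set 'I_m}) :
  [disjoint (I :|: J)%SET & L] = [disjoint I & L] && [disjoint J & L].
Proof. by rewrite !finset.disjoints_subset finset.subUset. Qed.

Lemma disjointsUr (I J L : {set 'I_m}) :
  [disjoint I & (J :|: L)%SET] = [disjoint I & J] && [disjoint I & L].
Proof. by rewrite disjoint_sym disjointsUl ![[disjoint I & _]]disjoint_sym. Qed.

(** On basis forms both sides carry the product of the signs of the three pairs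
    of index sets, since [sgn] is multiplicative in disjoint unions. *)
Lemma wedgeA alpha beta gamma :
  wedge alpha (wedge beta gamma) = wedge (wedge alpha beta) gamma.
Proof.
rewrite (ext_basis_sum alpha) !wedge_suml; apply: eq_bigr => I _.
rewrite (ext_basis_sum beta) wedge_sumr !wedge_suml wedge_sumr.
apply: eq_bigr => J _.
rewrite (ext_basis_sum gamma) !wedge_sumr.
apply: eq_bigr => L _.
rewrite !(wedgeZl, wedgeZr) !scalerA; congr (_ *: _); first by ring.
rewrite !wedge_basis; case: ifP => dJL; last first.
  rewrite wedge0r; case: ifP => dIJ; last by rewrite wedge0l.
  by rewrite wedgeZl wedge_basis disjointsUl dJL andbF scaler0.
rewrite wedgeZr wedge_basis disjointsUr.
case: ifP => [/andP[dIJ dIL]|].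
  rewrite dIJ wedgeZl wedge_basis disjointsUl dIL dJL /= finset.setUA.
  rewrite !scalerA; congr (_ *: _).
  by rewrite sgn_setUr// sgn_setUl//; ring.
rewrite scaler0; case: ifP => [dIJ /= dIL|_ _]; last by rewrite wedge0l.
by rewrite wedgeZl wedge_basis disjointsUl dIL scaler0.
Qed.

Lemma wedge_e_basis a S : wedge (e_ a) (ext_basis K S) =
  if a \in S then 0 else sgn K [set a]%SET S *: ext_basis K (a |: S)%SET.
Proof. by rewrite wedge_basis disjoints1; case: (a \in S). Qed.

Lemma wedge_eN a b alpha :
  wedge (e_ a) (wedge (e_ b) alpha) = - wedge (e_ b) (wedge (e_ a) alpha).
Proof.
rewrite !wedgeA -wedgeNl; congr (wedge _ _).
rewrite !wedge_e_basis !inE (eq_sym b).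
case: eqVneq => [_|ab]; first by rewrite oppr0.
by rewrite finset.setUC sgn11N// scaleNr.
Qed.

Lemma contractD a alpha beta :
  contract a (alpha + beta) = contract a alpha + contract a beta.
Proof.
by apply/ffunP => S; rewrite !ffunE; case: ifP; rewrite ?addr0// mulrDr.
Qed.

Lemma contractZ a k alpha : contract a (k *: alpha) = k *: contract a alpha.
Proof.
apply/ffunP => S; rewrite !ffunE; case: ifP; rewrite ?scaler0//.
by rewrite /GRing.scale /= mulrCA.
Qed.

Lemma contract0 a : contract a (0 : ext K m) = 0.
Proof. by rewrite -(scale0r (0 : ext K m)) contractZ !scale0r. Qed.

Lemma contract_sum a (T : Type) (r : seq T) (P : pred T) (F : T -> ext K m) :
  contract a (\sum_(i <- r | P i) F i) = \sum_(i <- r | P i) contract a (F i).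
Proof.
by elim/big_rec2: _ => [|i y x _ <-]; rewrite ?contract0// contractD.
Qed.

Lemma contract_basis a S : contract a (ext_basis K S) =
  if a \in S then sgn K [set a]%SET (S :\ a)%SET *: ext_basis K (S :\ a)%SET else 0.
Proof.
apply/ffunP => L; rewrite !ffunE.
case: ifPn => aL.
  case: ifPn => aS; rewrite !ffunE //.
  case: eqP => [LE|]; last by rewrite scaler0.
  by move: aL; rewrite LE !inE eqxx.
case: ifPn => aS; rewrite !ffunE.
  have -> : (a |: L == S)%SET = (L == S :\ a)%SET.
    apply/eqP/eqP => [<-|->]; last by rewrite finset.setD1K.
    by rewrite finset.setU1K.
  by case: eqP => [->|_]; rewrite /GRing.scale /= ?mulr1 ?mulr0.
case: eqP => [LE|]; last by rewrite mulr0.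
by move: aS; rewrite -LE !inE eqxx.
Qed.

(** The antiderivation rule for a left factor of degree one; iterating it
    handles all products.  On basis forms it comes down to the sign of exchanging
    two indices. *)
Lemma contract_wedge_e a b alpha :
  contract a (wedge (e_ b) alpha) =
  (a == b)%:R *: alpha - wedge (e_ b) (contract a alpha).
Proof.
rewrite (ext_basis_sum alpha) scaler_sumr !(wedge_sumr, contract_sum) -sumrB.
apply: eq_bigr => S _.
rewrite !(wedgeZr, contractZ) scalerA mulrC -scalerA -scalerBr; congr (_ *: _).
rewrite wedge_e_basis contract_basis.
case: (eqVneq a b) => [<-|ab].
  case: ifPn => aS.
    rewrite contract0 wedgeZr wedge_e_basis !inE eqxx /= scalerA.
    rewrite finset.setD1K// -expr2 /sgn sqrr_sign !scale1r.
    by rewrite subrr.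
  rewrite contractZ contract_basis finset.setU11 finset.setU1K// scalerA -expr2 sqrr_sign.
  by rewrite wedge0r subr0.
rewrite scale0r sub0r; case: ifPn => bS.
  rewrite contract0; case: ifP => aS; last by rewrite wedge0r oppr0.
  by rewrite wedgeZr wedge_e_basis !inE eq_sym ab bS scaler0 oppr0.
rewrite contractZ contract_basis !inE (negPf ab) /=.
case: ifP => aS; last by rewrite wedge0r scaler0 oppr0.
rewrite wedgeZr wedge_e_basis !inE (negPf bS) andbF.
have -> : ((b |: S) :\ a = b |: S :\ a)%SET.
  by apply/setP => x; rewrite !inE; case: (eqVneq x a) => [->|//]; rewrite (negPf ab).
rewrite !scalerA -scaleNr; congr (_ *: _).
have {1}-> : S = (a |: S :\ a)%SET by rewrite finset.setD1K.
rewrite !sgn_setUr ?disjoints1 ?inE ?eqxx ?(negPf bS) ?andbF//.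
rewrite (@sgn11N b a) 1?eq_sym// sgn11.
by case: (_ < _)%N; rewrite ?expr1 ?expr0; ring.
Qed.

(** ** Degrees *)

Definition homogeneous (p : nat) alpha := forall S, #|S| != p -> alpha S = 0.

Lemma homogeneous_wedge p q alpha beta : homogeneous p alpha ->
  homogeneous q beta -> homogeneous (p + q) (wedge alpha beta).
Proof.
move=> ha hb S Spq; rewrite ffunE big1// => I IS.
have [Ip|/ha->] := eqVneq #|I| p; last by rewrite mulr0 mul0r.
have [Iq|/hb->] := eqVneq #|(S :\: I)%SET| q; last by rewrite mulr0.
case/negP: Spq.
by rewrite -(finset.cardsID I S) (finset.setIidPr IS) Ip Iq.
Qed.

Lemma homogeneous_basis S : homogeneous #|S| (ext_basis K S).
Proof.
move=> I IS; rewrite ffunE (_ : (I == S) = false)//.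
by apply: contraNF IS => /eqP ->.
Qed.

Lemma homogeneous_sum p (T : Type) (r : seq T) (P : pred T) (F : T -> ext K m) :
  (forall i, P i -> homogeneous p (F i)) ->
  homogeneous p (\sum_(i <- r | P i) F i).
Proof.
by move=> h S Sp; rewrite sum_ffunE big1// => i Pi; rewrite h.
Qed.

Lemma homogeneousZ p k alpha : homogeneous p alpha -> homogeneous p (k *: alpha).
Proof. by move=> h S Sp; rewrite ffunE h// scaler0. Qed.

Lemma homogeneous_e a : homogeneous 1 (e_ a).
Proof. by have := @homogeneous_basis [set a]%SET; rewrite cards1. Qed.

Lemma homogeneous_gt p alpha : (m < p)%N -> homogeneous p alpha -> alpha = 0.
Proof.
move=> mp h; apply/ffunP => S; rewrite ffunE h// neq_ltn.
by rewrite (leq_ltn_trans _ mp)// -[X in (_ <= X)%N]card_ord max_card.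
Qed.

End Wedge.

(** * Powers of a nondegenerate two-form *)

Section SymplecticPowers.
Variables (K : numFieldType) (n : nat).
Notation m := (n + n)%N.
Variables (A P : 'M[K]_m).
Hypothesis PA : P *m (A - A^T) = 1%:M.
Implicit Types (a b c d : 'I_m) (alpha beta : ext K m).

Notation e_ a := (ext_basis K [set a]%SET).

(** The coefficient matrix need not be antisymmetric: only its antisymmetrization
    [A - A^T] matters, and the natural coefficients of a fundamental form are
    supported on pairs (dz, dzb). *)
Definition two_form : ext K m :=
  \sum_a \sum_b A a b *: wedge (e_ a) (e_ b).

(** The vector is the one that [two_form] identifies with e_d when P inverts
    [A - A^T]. *)
Definition dual_contract d alpha : ext K m := \sum_c P d c *: contract c alpha.

Notation Om := two_form.
Notation iv := dual_contract.
Notation pow := (wedge_pow two_form).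

Lemma wedge_two_form alpha : wedge Om alpha =
  \sum_a \sum_b A a b *: wedge (e_ a) (wedge (e_ b) alpha).
Proof.
rewrite wedge_suml; apply: eq_bigr => a _; rewrite wedge_suml.
by apply: eq_bigr => b _; rewrite wedgeZl wedgeA.
Qed.

Lemma wedge_two_form_comm a alpha :
  wedge Om (wedge (e_ a) alpha) = wedge (e_ a) (wedge Om alpha).
Proof.
rewrite !wedge_two_form wedge_sumr; apply: eq_bigr => b _.
rewrite wedge_sumr; apply: eq_bigr => c _; rewrite wedgeZr; congr (_ *: _).
by rewrite (wedge_eN c) wedgeNr wedge_eN opprK.
Qed.

Lemma dual_contractZ d k alpha : iv d (k *: alpha) = k *: iv d alpha.
Proof.
rewrite scaler_sumr; apply: eq_bigr => c _.
by rewrite contractZ !scalerA mulrC.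
Qed.

Lemma dual_contract0 d : iv d 0 = 0.
Proof. by rewrite -(scale0r (0 : ext K m)) dual_contractZ !scale0r. Qed.

Lemma dual_contract_wedge_e d a alpha :
  iv d (wedge (e_ a) alpha) = P d a *: alpha - wedge (e_ a) (iv d alpha).
Proof.
rewrite /iv wedge_sumr -sumrN.
under eq_bigr => c _ do rewrite contract_wedge_e scalerBr scalerA.
rewrite big_split /=; congr (_ + _); last first.
  by apply: eq_bigr => c _; rewrite wedgeZr.
rewrite (bigD1 a)//= eqxx mulr1 big1 ?addr0// => c ca.
by rewrite (negPf ca) mulr0 scale0r.
Qed.

Lemma contract_two_form c alpha : contract c (wedge Om alpha) =
  \sum_b (A - A^T) c b *: wedge (e_ b) alpha + wedge Om (contract c alpha).
Proof.
have -> : \sum_b (A - A^T) c b *: wedge (e_ b) alpha =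
    \sum_a \sum_b (A a b * (c == a)%:R) *: wedge (e_ b) alpha -
    \sum_a \sum_b (A a b * (c == b)%:R) *: wedge (e_ a) alpha.
  rewrite (exchange_big_dep predT)//= -sumrB; apply: eq_bigr => b _.
  rewrite -!scaler_suml -scalerBl !mxE; congr ((_ - _) *: _).
    by rewrite (bigD1 c)//= eqxx mulr1 big1 ?addr0// => i; rewrite eq_sym => /negPf ->; rewrite mulr0.
  by rewrite (bigD1 c)//= eqxx mulr1 big1 ?addr0// => i; rewrite eq_sym => /negPf ->; rewrite mulr0.
rewrite !wedge_two_form contract_sum -sumrB -big_split; apply: eq_bigr => a _ /=.
rewrite contract_sum -sumrB -big_split; apply: eq_bigr => b _ /=.
rewrite contractZ !contract_wedge_e wedgeDr wedgeNr wedgeZr opprD opprK addrA.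
by rewrite scalerDr scalerBr !scalerA.
Qed.

Lemma dual_contract_two_form d alpha :
  iv d (wedge Om alpha) = wedge (e_ d) alpha + wedge Om (iv d alpha).
Proof.
rewrite /iv; under eq_bigr => c _ do rewrite contract_two_form scalerDr.
rewrite big_split wedge_sumr /=; congr (_ + _); last first.
  by apply: eq_bigr => c _; rewrite wedgeZr.
under eq_bigr => c _ do rewrite scaler_sumr.
rewrite exchange_big (bigD1 d)//= [X in _ + X]big1 ?addr0 => [|b bd].
  under eq_bigr => c _ do rewrite scalerA.
  rewrite -scaler_suml; have /matrixP/(_ d d) := PA.
  by rewrite !mxE eqxx => ->; rewrite scale1r.
under eq_bigr => c _ do rewrite scalerA.
rewrite -scaler_suml; have /matrixP/(_ d b) := PA.
by rewrite !mxE eq_sym (negPf bd) => ->; rewrite scale0r.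
Qed.

(** Contraction is a derivation on the even form [two_form], whose powers commute
    with one-forms. *)
Lemma dual_contract_pow d k : iv d (pow k.+1) = k.+1%:R *: wedge (e_ d) (pow k).
Proof.
elim: k => [|k IH]; rewrite [pow _.+1]/= dual_contract_two_form -/(pow _).
  suff -> : iv d (ext_basis K finset.set0) = 0 by rewrite wedge0r addr0 scale1r.
  rewrite /iv big1// => c _; rewrite contract_basis inE.
  by rewrite scaler0.
by rewrite IH wedgeZr wedge_two_form_comm -[in RHS]nat1r scalerDl scale1r.
Qed.

Lemma homogeneous_two_form : homogeneous 2 Om.
Proof.
apply: homogeneous_sum => a _; apply: homogeneous_sum => b _.
by apply: homogeneousZ; apply: (@homogeneous_wedge _ _ 1 1); exact: homogeneous_e.
Qed.

Lemma homogeneous_pow k : homogeneous k.*2 (pow k).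
Proof.
elim: k => [|k IH]; last exact: (@homogeneous_wedge _ _ 2 k.*2 _ _ homogeneous_two_form IH).
by have := @homogeneous_basis K m finset.set0; rewrite cards0.
Qed.

(** ** Words in the coframe *)

Definition word (s : seq 'I_m) alpha := foldr (fun a => wedge (e_ a)) alpha s.

Lemma word_cat s t alpha : word (s ++ t) alpha = word s (word t alpha).
Proof. exact: foldr_cat. Qed.

Lemma wordZ s k alpha : word s (k *: alpha) = k *: word s alpha.
Proof. by elim: s => //= a s ->; rewrite wedgeZr. Qed.

Lemma wordB s alpha beta : word s (alpha - beta) = word s alpha - word s beta.
Proof. by elim: s => //= a s ->; rewrite wedgeDr wedgeNr. Qed.

Lemma homogeneous_word p s alpha :
  homogeneous p alpha -> homogeneous (size s + p) (word s alpha).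
Proof.
move=> h; elim: s => //= a s IH; rewrite addSn -add1n.
by apply: homogeneous_wedge => //; exact: homogeneous_e.
Qed.

Lemma word_pow0 s k : (m < size s + k.*2)%N -> word s (pow k) = 0.
Proof.
move=> lt; apply: (homogeneous_gt lt).
by apply: homogeneous_word; exact: homogeneous_pow.
Qed.

(** Contraction passes through a word when its shorter subwords kill the form. *)
Lemma dual_contract_word d alpha t s :
  (forall u, size u = (size t + size s).-1 -> word u alpha = 0) ->
  word t (iv d (word s alpha)) =
    (-1) ^+ size s *: word (t ++ s) (iv d alpha).
Proof.
elim: s t => [|a s IH] t kill /=; first by rewrite cats0 scale1r.
rewrite dual_contract_wedge_e wordB wordZ -word_cat kill ?scaler0 ?sub0r; last first.
  by rewrite size_cat addnS.
have -> : word t (wedge (e_ a) (iv d (word s alpha))) =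
    word (rcons t a) (iv d (word s alpha)) by rewrite -cats1 word_cat.
rewrite IH; last by move=> u; rewrite size_rcons addSnnS => /kill.
by rewrite cat_rcons exprS mulN1r scaleNr.
Qed.

Lemma ext_basis_word (S : {set 'I_m}) :
  exists (k : K) (s : seq 'I_m), size s = #|S| /\ ext_basis K S = k *: word s (ext_basis K finset.set0).
Proof.
move: {2}#|S| (erefl #|S|) => p; elim: p S => [|p IH] S cS.
  exists 1, [::]; rewrite cS; split=> //=.
  by rewrite scale1r (cards0_eq cS).
have [a aS] : exists a, a \in S by apply/card_gt0P; rewrite cS.
have [|k [s [ss Es]]] := IH (S :\ a)%SET.
  by rewrite (cardsD1 a) aS in cS; case: cS.
exists (sgn K [set a]%SET (S :\ a)%SET * k), (a :: s); split.
  by rewrite /= ss (cardsD1 a S) aS.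
rewrite /= -scalerA -wedgeZr -Es wedge_e_basis !inE eqxx /= finset.setD1K//.
by rewrite scalerA -expr2 sqrr_sign scale1r.
Qed.

(** If the top power vanished, contracting forms of degree above the dimension
    would show that all words of length 2p kill the (n-p)-th power, up to p = n,
    where it says that all top-degree forms vanish. *)
Lemma pow_top_neq0 : pow n != 0.
Proof.
apply/eqP => pow0.
have kill p : (p <= n)%N -> forall u, size u = p.*2 -> word u (pow (n - p)) = 0.
  elim: p => [|p IH] pn u su; first by case: u su => //= _; rewrite subn0.
  case/lastP: u su => // s d; rewrite size_rcons => -[ss].
  have /= := @dual_contract_word d (pow (n - p)) [::] s.
  rewrite word_pow0; last first.
    by rewrite ss -addnn; have := pn; move/ltnW/subnKC => {1}<-; lia.
  rewrite dual_contract0 ss /= => /(_ (IH (ltnW pn))) /esym/eqP.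
  rewrite scaler_eq0 signr_eq0 /= => /eqP.
  have -> : (n - p = (n - p.+1).+1)%N by rewrite subnS prednK// subn_gt0.
  rewrite dual_contract_pow wordZ => /eqP; rewrite scaler_eq0 pnatr_eq0 /= => /eqP.
  by rewrite -cats1 word_cat.
have [k [s [ss]]] := ext_basis_word finset.setT.
have -> : word s (ext_basis K finset.set0) = 0.
  have := kill n (leqnn n) s; rewrite subnn; apply.
  by rewrite ss cardsT card_ord addnn.
move=> /ffunP /(_ finset.setT); rewrite scaler0 !ffunE eqxx => /eqP.
by rewrite oner_eq0.
Qed.

End SymplecticPowers.

Section TopDegree.
Variables (K : numFieldType) (n : nat).
Notation m := (n.+2 + n.+2)%N.
Variables (A P : 'M[K]_m).
Hypothesis PA : P *m (A - A^T) = 1%:M.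
Notation e_ a := (ext_basis K [set a]%SET).
Notation pow := (wedge_pow (two_form A)).

(** Contract the zero form e_a Om^(n+2) by the vector dual to e_d. *)
Lemma wedge2_pow a d : n.+2%:R *: wedge (e_ a) (wedge (e_ d) (pow n.+1)) =
  P d a *: pow n.+2.
Proof.
have := dual_contract_wedge_e P d a (pow n.+2).
rewrite (_ : wedge _ _ = 0) ?dual_contract0; last first.
  by apply: (@word_pow0 _ _ _ [:: a]); rewrite /= -addnn; lia.
by rewrite (dual_contract_pow PA) wedgeZr => /eqP; rewrite eq_sym subr_eq0 => /eqP.
Qed.

(** Contract the zero form e_a e_b e_c Om^(n+1) by the vector dual to e_d: three of
    the four terms are given by [wedge2_pow]. *)
Lemma wedge4_pow a b c d :
  (n.+2 * n.+1)%:R *: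
    wedge (e_ a) (wedge (e_ b) (wedge (e_ c) (wedge (e_ d) (pow n)))) =
  (P d a * P c b - P d b * P c a + P d c * P b a) *: pow n.+2.
Proof.
have := dual_contract_wedge_e P d a (wedge (e_ b) (wedge (e_ c) (pow n.+1))).
rewrite (_ : wedge _ _ = 0) ?dual_contract0; last first.
  by apply: (@word_pow0 _ _ _ [:: a; b; c]); rewrite /= -addnn; lia.
rewrite !dual_contract_wedge_e (dual_contract_pow PA).
rewrite !(wedgeDr, wedgeNr, wedgeZr).
have reduce k x y : n.+2%:R *: (k *: wedge (e_ x) (wedge (e_ y) (pow n.+1))) =
    (k * P y x) *: pow n.+2.
  by rewrite scalerA (mulrC _ k) -[LHS]scalerA wedge2_pow scalerA.
move/(congr1 (fun w => n.+2%:R *: w)).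
rewrite scaler0 !opprD !opprK !scalerDr !scalerN !reduce scalerA -natrM.
rewrite !addrA => /esym/eqP; rewrite subr_eq0 => /eqP <-.
by rewrite -scalerBl -scalerDl.
Qed.

End TopDegree.

Lemma wedge4_pow_sub2 (K : numFieldType) (n : nat) (A P : 'M[K]_(n + n))
    (a b c d : 'I_(n + n)) : (2 <= n)%N -> P *m (A - A^T) = 1%:M ->
  (n * n.-1)%:R *: wedge (ext_basis K [set a]%SET)
      (wedge (ext_basis K [set b]%SET) (wedge (ext_basis K [set c]%SET)
        (wedge (ext_basis K [set d]%SET) (wedge_pow (two_form A) (n - 2))))) =
  (P d a * P c b - P d b * P c a + P d c * P b a) *: wedge_pow (two_form A) n.
Proof.
case: n A P a b c d => [|[|n]]// A P a b c d _ PA.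
by rewrite !subSS subn0; exact: wedge4_pow.
Qed.

(** * Calculus of complex-valued functions *)

Section ComplexParts.
Local Open Scope complex_scope.
Local Open Scope ring_scope.
Variable R : rcfType.
Implicit Types z w : R[i].

Lemma ReD z w : complex.Re (z + w) = complex.Re z + complex.Re w.
Proof. by case: z; case: w. Qed.

Lemma ImD z w : complex.Im (z + w) = complex.Im z + complex.Im w.
Proof. by case: z; case: w. Qed.

Lemma ReM z w : complex.Re (z * w) =
  complex.Re z * complex.Re w - complex.Im z * complex.Im w.
Proof. by case: z; case: w. Qed.

Lemma ImM z w : complex.Im (z * w) =
  complex.Re z * complex.Im w + complex.Im z * complex.Re w.
Proof. by case: z; case: w. Qed.

Lemma ReJ z : complex.Re z^*%C = complex.Re z.
Proof. by case: z. Qed.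

Lemma ImJ z : complex.Im z^*%C = - complex.Im z.
Proof. by case: z. Qed.

Lemma normC2_neq0 z : z != 0 -> complex.Re z * complex.Re z + complex.Im z * complex.Im z != 0.
Proof.
case: z => a b; apply: contra => /=.
by rewrite -!expr2 paddr_eq0 ?sqr_ge0// !sqrf_eq0 => /andP[/eqP -> /eqP ->].
Qed.

Lemma ReV z : complex.Re z^-1 =
  complex.Re z * (complex.Re z * complex.Re z + complex.Im z * complex.Im z)^-1.
Proof. by case: z => a b /=; rewrite -!expr2. Qed.

Lemma ImV z : complex.Im z^-1 =
  - complex.Im z * (complex.Re z * complex.Re z + complex.Im z * complex.Im z)^-1.
Proof. by case: z => a b /=; rewrite -!expr2 mulNr. Qed.

End ComplexParts.

Section ComplexDerivatives.
Local Open Scope complex_scope.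
Local Open Scope ring_scope.
Variables (R : realType) (n : nat).
Notation E := 'rV[R]_(n + n).
Notation C := R[i].
Implicit Types (f g : E -> C) (x v : E).

(** Differentiability along every line through x, which is weaker than Frechet
    differentiability and is what iterated directional derivatives provide.  A
    record keeps it from being unfolded. *)
Record cdiff f x : Prop := Cdiff {
  cdiff_parts : forall v, derivable (fun y => complex.Re (f y)) x v /\
                          derivable (fun y => complex.Im (f y)) x v }.

Lemma cdiff_cst k x : cdiff (fun=> k) x.
Proof. by split=> v; split; exact: derivable_cst. Qed.

Lemma cderive_cst k v x : cderive v (fun=> k) x = 0.
Proof. by rewrite /cderive !derive_cst. Qed.

Lemma cdiff_real (u : E -> R) x : (forall v, derivable u x v) ->
  cdiff (fun y => (u y)%:C) x.
Proof. by move=> du; split=> v; split; [exact: du|exact: derivable_cst]. Qed.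

Lemma cderive_real (u : E -> R) v x : cderive v (fun y => (u y)%:C) x = ('D_v u x)%:C.
Proof. by rewrite /cderive /= derive_cst. Qed.

Let re f : E -> R := fun y => complex.Re (f y).
Let im f : E -> R := fun y => complex.Im (f y).

Let re_add f g : re (fun y => f y + g y) = re f + re g.
Proof. by apply/funext => y; rewrite /re ReD. Qed.

Let im_add f g : im (fun y => f y + g y) = im f + im g.
Proof. by apply/funext => y; rewrite /im ImD. Qed.

Let re_mul f g : re (fun y => f y * g y) = re f * re g - im f * im g.
Proof. by apply/funext => y; rewrite /re ReM. Qed.

Let im_mul f g : im (fun y => f y * g y) = re f * im g + im f * re g.
Proof. by apply/funext => y; rewrite /im ImM. Qed.

Lemma cdiffD f g x : cdiff f x -> cdiff g x -> cdiff (fun y => f y + g y) x.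
Proof.
move=> df dg; split=> v; have [fR fI] := cdiff_parts df v; have [gR gI] := cdiff_parts dg v; split.
  by rewrite -/(re _) re_add; exact: (derivableD fR gR).
by rewrite -/(im _) im_add; exact: (derivableD fI gI).
Qed.

Lemma cderiveD f g v x : cdiff f x -> cdiff g x ->
  cderive v (fun y => f y + g y) x = cderive v f x + cderive v g x.
Proof.
move=> df dg; have [fR fI] := cdiff_parts df v; have [gR gI] := cdiff_parts dg v; rewrite /cderive.
rewrite -/(re _) -/(im _) re_add im_add.
by rewrite (deriveD fR gR) (deriveD fI gI).
Qed.

Lemma cdiffM f g x : cdiff f x -> cdiff g x -> cdiff (fun y => f y * g y) x.
Proof.
move=> df dg; split=> v; have [fR fI] := cdiff_parts df v; have [gR gI] := cdiff_parts dg v; split.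
  rewrite -/(re _) re_mul.
  exact: (derivableB (derivableM fR gR) (derivableM fI gI)).
rewrite -/(im _) im_mul.
exact: (derivableD (derivableM fR gI) (derivableM fI gR)).
Qed.

Lemma cderiveM f g v x : cdiff f x -> cdiff g x ->
  cderive v (fun y => f y * g y) x = cderive v f x * g x + f x * cderive v g x.
Proof.
move=> df dg; have [fR fI] := cdiff_parts df v; have [gR gI] := cdiff_parts dg v; rewrite /cderive.
rewrite -/(re _) -/(im _) re_mul im_mul.
rewrite (deriveB (derivableM fR gR) (derivableM fI gI)).
rewrite (deriveD (derivableM fR gI) (derivableM fI gR)).
rewrite (deriveM fR gR) (deriveM fI gI) (deriveM fR gI) (deriveM fI gR).
rewrite /GRing.scale /=.
move: ('D_v (re f) x) ('D_v (im f) x) ('D_v (re g) x) ('D_v (im g) x) => p q r s.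
rewrite /re /im; case: (f x) => a b; case: (g x) => c d /=; apply/eqP; rewrite eq_complex /=; apply/andP.
by split; apply/eqP; ring.
Qed.

Lemma cdiffV f x : f x != 0 -> cdiff f x -> cdiff (fun y => (f y)^-1) x.
Proof.
move=> fx0 df; split=> v; have [fR fI] := cdiff_parts df v.
pose N : E -> R := re f * re f + im f * im f.
have dN : derivable (fun y => (N y)^-1) x v.
  apply: derivableV; first exact: normC2_neq0.
  exact: (derivableD (derivableM fR fR) (derivableM fI fI)).
split.
  have -> : (fun y => complex.Re (f y)^-1) = re f * (fun y => (N y)^-1).
    by apply/funext => y; rewrite ReV.
  exact: derivableM fR dN.
have -> : (fun y => complex.Im (f y)^-1) = - im f * (fun y => (N y)^-1).
  by apply/funext => y; rewrite ImV.
exact: derivableM (derivableN fI) dN.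
Qed.

Let im_conj f : im (fun y => (f y)^*%C) = - im f.
Proof. by apply/funext => y; rewrite /im ImJ. Qed.

Let re_conj f : re (fun y => (f y)^*%C) = re f.
Proof. by apply/funext => y; rewrite /re ReJ. Qed.

Lemma cderiveJ f v x : cdiff f x ->
  cderive v (fun y => (f y)^*%C) x = (cderive v f x)^*%C.
Proof.
move=> df; have [fR fI] := cdiff_parts df v; rewrite /cderive.
by rewrite -/(re _) -/(im _) re_conj im_conj (deriveN fI).
Qed.

(** Identities between coefficients hold only on an open set; these lemmas allow
    differentiating them there. *)
Section Germs.
Variables (V : set E) (x : E).
Hypotheses (oV : open V) (Vx : V x).

Lemma cdiff_germ f g : (forall y, V y -> f y = g y) -> cdiff f x -> cdiff g x.
Proof.
move=> fg df; split=> v; have [fR fI] := cdiff_parts df v.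
have nV : \forall y \near x, V y by exact: open_nbhs_nbhs.
by split; [move: fR|move: fI]; apply: near_eq_derivable; near=> y;
  rewrite fg//; near: y.
Unshelve. all: by end_near. Qed.

Lemma cderive_germ v f g : (forall y, V y -> f y = g y) ->
  cderive v f x = cderive v g x.
Proof.
move=> fg; have nV : \forall y \near x, V y by exact: open_nbhs_nbhs.
by congr (_ +i* _); apply: near_eq_derive; near=> y; rewrite fg//; near: y.
Unshelve. all: by end_near. Qed.

End Germs.

(** ** Derivatives along the complex frame *)

Definition dframe (a : 'I_(n + n)) f x : C :=
  \sum_b frame R n a b * cderive (delta_mx 0 b) f x.

Lemma fderiveE a (alpha : E -> ext C (n + n)) x S :
  fderive a alpha x S = dframe a (fun y => alpha y S) x.
Proof. by rewrite ffunE. Qed.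

Lemma dframe_cst a k x : dframe a (fun=> k) x = 0.
Proof. by rewrite /dframe big1// => b _; rewrite cderive_cst mulr0. Qed.

Lemma dframeD a f g x : cdiff f x -> cdiff g x ->
  dframe a (fun y => f y + g y) x = dframe a f x + dframe a g x.
Proof.
move=> df dg; rewrite -big_split; apply: eq_bigr => b _ /=.
by rewrite cderiveD// mulrDr.
Qed.

Lemma dframeM a f g x : cdiff f x -> cdiff g x ->
  dframe a (fun y => f y * g y) x = dframe a f x * g x + f x * dframe a g x.
Proof.
move=> df dg; rewrite mulr_suml mulr_sumr -big_split; apply: eq_bigr => b _ /=.
by rewrite cderiveM//; ring.
Qed.

Lemma dframeZ a k f x : cdiff f x ->
  dframe a (fun y => k * f y) x = k * dframe a f x.
Proof.
move=> df; rewrite dframeM ?dframe_cst ?mul0r ?add0r//; exact: cdiff_cst.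
Qed.

Lemma cdiffZ k f x : cdiff f x -> cdiff (fun y => k * f y) x.
Proof. by move=> df; apply: cdiffM => //; exact: cdiff_cst. Qed.

Lemma cdiffN f x : cdiff f x -> cdiff (fun y => - f y) x.
Proof. by under eq_fun do rewrite -mulN1r; exact: cdiffZ. Qed.

Lemma dframeN a f x : cdiff f x -> dframe a (fun y => - f y) x = - dframe a f x.
Proof. by move=> df; under eq_fun do rewrite -mulN1r; rewrite dframeZ// mulN1r. Qed.

Lemma cdiffB f g x : cdiff f x -> cdiff g x -> cdiff (fun y => f y - g y) x.
Proof. by move=> df dg; apply: cdiffD => //; exact: cdiffN. Qed.

Lemma dframeB a f g x : cdiff f x -> cdiff g x ->
  dframe a (fun y => f y - g y) x = dframe a f x - dframe a g x.
Proof. by move=> df dg; rewrite dframeD ?dframeN//; exact: cdiffN. Qed.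

Lemma cdiff_sum (T : Type) (r : seq T) (P : pred T) (F : T -> E -> C) x :
  (forall i, P i -> cdiff (F i) x) -> cdiff (fun y => \sum_(i <- r | P i) F i y) x.
Proof.
move=> dF; elim: r => [|i r IH].
  by under eq_fun do rewrite big_nil; exact: cdiff_cst.
under eq_fun do rewrite big_cons.
by case Pi: (P i) => //=; apply: cdiffD => //; exact: dF.
Qed.

Lemma dframe_sum a (T : Type) (r : seq T) (P : pred T) (F : T -> E -> C) x :
  (forall i, P i -> cdiff (F i) x) ->
  dframe a (fun y => \sum_(i <- r | P i) F i y) x =
  \sum_(i <- r | P i) dframe a (F i) x.
Proof.
move=> dF; elim: r => [|i r IH].
  by under eq_fun do rewrite big_nil; rewrite dframe_cst big_nil.
under eq_fun do rewrite big_cons; rewrite big_cons.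
case Pi: (P i) => //=; rewrite dframeD ?IH//; first exact: dF.
exact: cdiff_sum.
Qed.

Lemma dframe_germ (V : set E) a f g x : open V -> V x ->
  (forall y, V y -> f y = g y) -> dframe a f x = dframe a g x.
Proof.
by move=> oV Vx fg; apply: eq_bigr => b _; rewrite (cderive_germ oV Vx _ fg).
Qed.

Lemma cdiff_prod (T : Type) (r : seq T) (P : pred T) (F : T -> E -> C) x :
  (forall i, P i -> cdiff (F i) x) -> cdiff (fun y => \prod_(i <- r | P i) F i y) x.
Proof.
move=> dF; elim: r => [|i r IH].
  by under eq_fun do rewrite big_nil; exact: cdiff_cst.
under eq_fun do rewrite big_cons.
by case Pi: (P i) => //=; apply: cdiffM => //; exact: dF.
Qed.

(** ** Matrices of functions *)

Section Matrices.
Variable (k : nat).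
Implicit Type A : E -> 'M[C]_k.

Lemma cdiff_det A x : (forall i j, cdiff (fun y => A y i j) x) ->
  cdiff (fun y => \det (A y)) x.
Proof.
move=> dA; apply: cdiff_sum => s _; apply: cdiffZ.
by apply: cdiff_prod => i _; exact: dA.
Qed.

Lemma dframe_prod a (F : 'I_k -> E -> C) x : (forall i, cdiff (F i) x) ->
  dframe a (fun y => \prod_i F i y) x =
  \sum_i \prod_j (if j == i then dframe a (F j) x else F j x).
Proof.
move=> dF.
have gen (r : seq 'I_k) : uniq r -> dframe a (fun y => \prod_(i <- r) F i y) x =
    \sum_(i <- r) \prod_(j <- r) (if j == i then dframe a (F j) x else F j x).
  elim: r => [_|i r IH /= /andP[ir ur]].
    by under eq_fun do rewrite big_nil; rewrite dframe_cst big_nil.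
  under eq_fun do rewrite big_cons.
  rewrite dframeM//; last by apply: cdiff_prod => j _; exact: dF.
  rewrite IH// !big_cons eqxx; congr (_ * _ + _).
    by apply: eq_big_seq => j jr; case: eqP ir jr => // -> /negPf ->.
  rewrite big_distrr /=; apply: eq_big_seq => j jr.
  by rewrite big_cons; case: eqP ir jr => // -> /negPf ->.
exact: gen (index_enum_uniq _).
Qed.

(** Jacobi's formula: differentiate the Leibniz expansion, one row at a time. *)
Lemma dframe_det a A x : (forall i j, cdiff (fun y => A y i j) x) ->
  dframe a (fun y => \det (A y)) x =
  \sum_i \sum_j dframe a (fun y => A y i j) x * cofactor (A x) i j.
Proof.
move=> dA.
pose B i : 'M[C]_k := \matrix_(p, q)
  if p == i then dframe a (fun y => A y p q) x else A x p q.
transitivity (\sum_i \det (B i)).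
  rewrite /determinant exchange_big /= dframe_sum; last first.
    move=> s _; apply: cdiffZ; apply: cdiff_prod => i _; exact: dA.
  apply: eq_bigr => s _; rewrite dframeZ; last first.
    by apply: cdiff_prod => i _; exact: dA.
  rewrite dframe_prod; last by move=> i; exact: dA.
  rewrite mulr_sumr; apply: eq_bigr => i _; congr (_ * _).
  by apply: eq_bigr => j _; rewrite mxE.
apply: eq_bigr => i _; rewrite (expand_det_row _ i); apply: eq_bigr => j _.
rewrite mxE eqxx; congr (_ * _); rewrite /cofactor; congr (_ * \det _).
by apply/matrixP => p q; rewrite !mxE eq_sym (negPf (neq_lift _ _)).
Qed.

Lemma dframe_det_unit a A x : A x \in unitmx ->
  (forall i j, cdiff (fun y => A y i j) x) ->
  dframe a (fun y => \det (A y)) x =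
  \det (A x) * \sum_i \sum_j invmx (A x) j i * dframe a (fun y => A y i j) x.
Proof.
move=> uA dA; rewrite dframe_det// mulr_sumr; apply: eq_bigr => i _.
rewrite mulr_sumr; apply: eq_bigr => j _; rewrite /invmx uA !mxE.
rewrite !mulrA divff ?mul1r; last by rewrite -unitfE -unitmxE.
by rewrite -mulrA mulrC -mulrA.

Qed.

Lemma cdiff_invmx (V : set E) A x i j : open V -> V x ->
  (forall y, V y -> A y \in unitmx) ->
  (forall i j, cdiff (fun y => A y i j) x) ->
  cdiff (fun y => invmx (A y) i j) x.
Proof.
move=> oV Vx uA dA.
apply: (@cdiff_germ V x oV Vx (fun y => (\det (A y))^-1 * cofactor (A y) j i)).
  by move=> y /uA uAy; rewrite /invmx uAy !mxE.
apply: cdiffM.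
  apply: cdiffV; last exact: cdiff_det.
  by have := uA _ Vx; rewrite unitmxE unitfE.
apply: cdiffZ; rewrite /determinant; apply: cdiff_sum => s _; apply: cdiffZ.
apply: cdiff_prod => p _; under eq_fun do rewrite !mxE; exact: dA.
Qed.

(** Differentiate A^-1 A = 1. *)
Lemma dframe_invmx (V : set E) A a x i j : open V -> V x ->
  (forall y, V y -> A y \in unitmx) ->
  (forall i j, cdiff (fun y => A y i j) x) ->
  dframe a (fun y => invmx (A y) i j) x =
  - \sum_p \sum_q invmx (A x) i p * dframe a (fun y => A y p q) x * invmx (A x) q j.
Proof.
move=> oV Vx uA dA.
pose dI p q := dframe a (fun y => invmx (A y) p q) x.
have dinv p q : cdiff (fun y => invmx (A y) p q) x by exact: (cdiff_invmx _ _ oV Vx).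
have key q : \sum_p dI i p * A x p q +
    \sum_p invmx (A x) i p * dframe a (fun y => A y p q) x = 0.
  rewrite -big_split /=.
  transitivity (dframe a (fun y => \sum_p invmx (A y) i p * A y p q) x).
    rewrite dframe_sum; last by move=> p _; exact: cdiffM.
    by apply: eq_bigr => p _; rewrite dframeM.
  rewrite (@dframe_germ V _ _ (fun=> 1%:M i q) x oV Vx) ?dframe_cst// => y Vy.
  by rewrite -(mulVmx (uA y Vy)) [RHS]mxE.
have -> : dframe a (fun y => invmx (A y) i j) x =
    \sum_q (\sum_p dI i p * A x p q) * invmx (A x) q j.
  under eq_bigr => q _ do rewrite mulr_suml.
  rewrite exchange_big /= (bigD1 j)//= [X in _ + X]big1 ?addr0 => [|p pj].
    under eq_bigr => q _ do rewrite -mulrA; rewrite -mulr_sumr.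
    have /matrixP/(_ j j) := mulmxV (uA x Vx).
    by rewrite !mxE eqxx => ->; rewrite mulr1.
  under eq_bigr => q _ do rewrite -mulrA; rewrite -mulr_sumr.
  have /matrixP/(_ p j) := mulmxV (uA x Vx).
  by rewrite !mxE (negPf pj) => ->; rewrite mulr0.
rewrite exchange_big -sumrN; apply: eq_bigr => q _.
have /eqP := key q; rewrite addr_eq0 => /eqP ->.
by rewrite mulNr mulr_suml.
Qed.

End Matrices.
End ComplexDerivatives.

Local Open Scope sesquilinear_scope.

(** * Positive definite Hermitian matrices *)

Section PositiveDefinite.
Variables (C : numClosedFieldType) (n : nat).
Implicit Types A B h q : 'M[C]_n.

Definition posdefmx A :=
  A ^t* = A /\ forall u : 'rV[C]_n, u != 0 -> 0 < (u *m A *m u ^t*) 0 0.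

(** Diagonalize by a unitary matrix and take square roots of the eigenvalues. *)
Lemma posdef_factor A : posdefmx A ->
  exists2 B, B \in unitmx & A = B *m B ^t*.
Proof.
case=> hA pA; pose P := spectralmx A; pose d := spectral_diag A.
have uP : P \is unitarymx by exact: spectral_unitarymx.
have AE : A = P ^t* *m diag_mx d *m P.
  rewrite -invmx_unitary//; apply/orthomx_spectralP/hermitian_normalmx.
  by apply/is_hermitianmxP; rewrite expr0 scale1r hA.
have PP : P *m P ^t* = 1%:M by exact/unitarymxP.
have PP' : P ^t* *m P = 1%:M by exact: mulmx1C.
have d_gt0 i : 0 < d 0 i.
  have -> : d 0 i = (row i P *m A *m (row i P) ^t*) 0 0.
    transitivity ((P *m A *m P ^t*) i i).
      by rewrite AE !mulmxA PP mul1mx -mulmxA PP mulmx1 mxE eqxx mulr1n.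
    by rewrite -row_mul !mxE; apply: eq_bigr => j _; rewrite !mxE.
  apply: pA; apply/eqP => /(congr1 (mulmx^~ (P ^t*))).
  rewrite -row_mul PP mul0mx => /rowP/(_ i)/eqP.
  by rewrite !mxE eqxx oner_eq0.
pose S := diag_mx (\row_i sqrtC (d 0 i)).
have SS : S *m S ^t* = diag_mx d.
  rewrite tr_diag_mx map_diag_mx mulmx_diag; congr diag_mx; apply/rowP => i.
  by rewrite !mxE -normCK ger0_norm ?sqrtC_ge0 1?ltW// sqrtCK.
exists (P ^t* *m S); last first.
  by rewrite trmx_mul map_mxM trmxCK mulmxA -(mulmxA _ S) SS.
rewrite unitmx_mul; apply/andP; split; first by apply: (mulmx1_unit PP').1.
rewrite unitmxE unitfE det_diag; apply/prodf_neq0 => i _.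
by rewrite mxE sqrtC_eq0 gt_eqF.
Qed.

Lemma posdef_det A : posdefmx A -> 0 < \det A.
Proof.
move=> /posdef_factor[B uB ->].
rewrite det_mulmx det_map_mx det_tr -normCK exprn_gt0// normr_gt0.
by rewrite -unitfE -unitmxE.
Qed.

(** The squared norm of a tensor is definite: with q = (D^* D)^T, the sum is that of
    the |T3|^2, where T3 is T transformed in its three indices by D or its
    conjugate, and D is invertible. *)
Lemma posdef_tensor h q (T : 'I_n -> 'I_n -> 'I_n -> C) : posdefmx h ->
  h *m q^T = 1%:M ->
  \sum_i \sum_k q i k * \sum_a \sum_l q a l * \sum_j \sum_b q j b *
    ((T k l j)^* * T i a b) = 0 ->
  forall i a b, T i a b = 0.
Proof.
move=> /posdef_factor[B uB hE] hq.
pose D := invmx B.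
have qE i k : q i k = \sum_m (D m k)^* * D m i.
  have -> : q = (D ^t* *m D)^T.
    apply: (can_inj (@trmxK _ _ _)); rewrite trmxK.
    have DB : D ^t* *m B ^t* = 1%:M.
      by rewrite -map_mxM -trmx_mul mulmxV// trmx1 map_mx1.
    rewrite -[LHS]mul1mx -DB -[RHS]mulmx1 -hq hE !mulmxA.
    by rewrite -(mulmxA _ D) mulVmx// mulmx1.
  by rewrite !mxE; apply: eq_bigr => m _; rewrite !mxE.
have step (f g : 'I_n -> C) : \sum_i \sum_k q i k * ((g k)^* * f i) =
    \sum_m (\sum_k D m k * g k)^* * (\sum_i D m i * f i).
  transitivity (\sum_i \sum_k \sum_m (D m k * g k)^* * (D m i * f i)).
    apply: eq_bigr => i _; apply: eq_bigr => k _; rewrite qE mulr_suml.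
    by apply: eq_bigr => m _; rewrite rmorphM /=; ring.
  rewrite exchange_big; under eq_bigr => k _ do rewrite exchange_big.
  rewrite exchange_big /=; apply: eq_bigr => m _.
  rewrite rmorph_sum mulr_suml; apply: eq_bigr => k _.
  by rewrite mulr_sumr.
have stepJ (f g : 'I_n -> C) : \sum_i \sum_k q i k * ((g i)^* * f k) =
    \sum_m (\sum_k (D m k)^* * g k)^* * (\sum_i (D m i)^* * f i).
  transitivity (\sum_i \sum_k \sum_m (D m i * (g i)^*) * ((D m k)^* * f k)).
    apply: eq_bigr => i _; apply: eq_bigr => k _; rewrite qE mulr_suml.
    by apply: eq_bigr => m _; ring.
  under eq_bigr => k _ do rewrite exchange_big.
  rewrite exchange_big /=; apply: eq_bigr => m _.
  rewrite rmorph_sum mulr_suml; apply: eq_bigr => k _.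
  by rewrite rmorphM /= conjCK mulr_sumr.
have inj (f : 'I_n -> C) : (forall m, \sum_i D m i * f i = 0) -> forall i, f i = 0.
  move=> Df i; have : D *m (\col_i f i) = 0.
    by apply/colP => m; rewrite !mxE -[RHS](Df m); apply: eq_bigr => k _; rewrite mxE.
  move/(congr1 (mulmx B)); rewrite mulmxA mulmxV// mul1mx mulmx0.
  by move/colP/(_ i); rewrite !mxE.
have injJ (f : 'I_n -> C) : (forall m, \sum_i (D m i)^* * f i = 0) -> forall i, f i = 0.
  move=> Df i; apply/eqP; rewrite -conjC_eq0; apply/eqP; move: i; apply: inj => m.
  have := congr1 Num.conj (Df m); rewrite rmorph_sum rmorph0; apply: etrans.
  by apply: eq_bigr => i _; rewrite rmorphM /= conjCK.
pose T1 i a m := \sum_b (D m b)^* * T i a b.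
pose T2 i m' m := \sum_a D m' a * T1 i a m.
pose T3 p m' m := \sum_i D p i * T2 i m' m.
have inner i k : \sum_a \sum_l q a l * (\sum_j \sum_b q j b *
    ((T k l j)^* * T i a b)) =
    \sum_m \sum_m' (T2 k m' m)^* * T2 i m' m.
  transitivity (\sum_a \sum_l \sum_m q a l * ((T1 k l m)^* * T1 i a m)).
    apply: eq_bigr => a _; apply: eq_bigr => l _.
    by rewrite (stepJ (T i a) (T k l)) mulr_sumr.
  under eq_bigr => a _ do rewrite exchange_big.
  rewrite exchange_big; apply: eq_bigr => m _.
  exact: (step (T1 i ^~ m) (T1 k ^~ m)).
under eq_bigr => i _ do under eq_bigr => k _ do rewrite inner mulr_sumr.
under eq_bigr => i _ do under eq_bigr => k _ do under eq_bigr => m _ do rewrite mulr_sumr.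
move=> S0.
have {S0} : \sum_m \sum_m' \sum_p `|T3 p m' m| ^+ 2 = 0.
  rewrite -[RHS]S0; under [RHS]eq_bigr => i _ do rewrite exchange_big.
  rewrite [RHS]exchange_big; apply: eq_bigr => m _ /=.
  under [RHS]eq_bigr => i _ do rewrite exchange_big.
  rewrite [RHS]exchange_big; apply: eq_bigr => m' _ /=.
  rewrite (step (fun i => T2 i m' m) (fun i => T2 i m' m)).
  by apply: eq_bigr => p _; rewrite normCKC.
move=> S0 i a; apply: (injJ (T i a)) => m.
move: a; apply: (inj (T1 i ^~ m)) => m'.
move: i; apply: (inj (fun i => T2 i m' m)) => p; rewrite -/(T3 p m' m).
apply/eqP; rewrite -normr_eq0 -sqrf_eq0; apply/eqP.
have ge0 x y z : 0 <= `|T3 x y z| ^+ 2 by exact: exprn_ge0.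
move: S0 => /eqP; rewrite psumr_eq0; last by move=> *; do 2!apply: sumr_ge0 => *.
move/allP/(_ m (mem_index_enum _)); rewrite psumr_eq0; last by move=> *; apply: sumr_ge0 => *.
move/allP/(_ m' (mem_index_enum _)); rewrite psumr_eq0//.
by move/allP/(_ p (mem_index_enum _))/eqP.
Qed.

End PositiveDefinite.

(** * Contractions of arrays *)

Section Contractions.
Variables (K : comRingType) (n : nat).
Implicit Types (q : 'I_n -> 'I_n -> K) (S T : 'I_n -> 'I_n -> 'I_n -> K).

Let swap_sum T : \sum_k \sum_j \sum_l T k j l = \sum_k \sum_j \sum_l T l j k.
Proof.
rewrite exchange_big /=; under eq_bigr => j _ do rewrite exchange_big.
by rewrite exchange_big.
Qed.

(** For D = d_i dbar_k h_jl, the left side is what [wedge4_pow] makes of the product of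
    d dbar Omega with Omega^(n-2). *)
Lemma sum_antisym4 q (D : 'I_n -> 'I_n -> 'I_n -> 'I_n -> K) (c : K) :
  \sum_i \sum_k \sum_j \sum_l (c * D i k j l) * (q i l * q j k - q i k * q j l) =
  - c * \sum_i \sum_k \sum_j \sum_l q i k * q j l * (D i k j l - D i l j k).
Proof.
rewrite mulr_sumr; apply: eq_bigr => i _.
transitivity (\sum_k \sum_j \sum_l - c * (q i k * q j l * D i k j l) +
  \sum_k \sum_j \sum_l c * (q i l * q j k * D i k j l)).
  rewrite -big_split; apply: eq_bigr => k _.
  rewrite -big_split; apply: eq_bigr => j _.
  by rewrite -big_split; apply: eq_bigr => l _ /=; ring.
rewrite [X in _ + X]swap_sum -big_split mulr_sumr; apply: eq_bigr => k _.
rewrite -big_split mulr_sumr; apply: eq_bigr => j _.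
by rewrite -big_split mulr_sumr; apply: eq_bigr => l _ /=; ring.
Qed.

(** Exchanging (i, k) with (a, l) changes the sign of S, so the terms in [D i a b]
    and in [- D a i b] have the same sum. *)
Lemma sum_antisym6 q S (D : 'I_n -> 'I_n -> 'I_n -> K) :
  (forall k l j, S l k j = - S k l j) ->
  \sum_i \sum_k q i k * (\sum_a \sum_l q a l * (\sum_j \sum_b q j b *
    (S k l j * D i a b))) = 0 ->
  \sum_i \sum_k q i k * (\sum_a \sum_l q a l * (\sum_j \sum_b q j b *
    (S k l j * (D i a b - D a i b)))) = 0.
Proof.
move=> Santi S0.
pose W i k a l := q i k * (q a l * \sum_j \sum_b q j b * (S k l j * D i a b)).
have WE : \sum_i \sum_k \sum_a \sum_l W i k a l = 0.
  rewrite -[RHS]S0; apply: eq_bigr => i _; apply: eq_bigr => k _.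
  rewrite mulr_sumr; apply: eq_bigr => a _; rewrite mulr_sumr.
  by apply: eq_bigr => l _.
transitivity (\sum_i \sum_k \sum_a \sum_l W i k a l +
    \sum_i \sum_k \sum_a \sum_l W a l i k).
  rewrite -big_split; apply: eq_bigr => i _.
  rewrite -big_split; apply: eq_bigr => k _.
  rewrite mulr_sumr -big_split; apply: eq_bigr => a _.
  rewrite mulr_sumr -big_split; apply: eq_bigr => l _ /=.
  rewrite /W (mulrCA (q a l)) -!mulrDr -big_split; do 2!congr (_ * _).
  apply: eq_bigr => j _; rewrite -big_split; apply: eq_bigr => b _ /=.
  by rewrite (Santi k); ring.
rewrite WE add0r -[RHS]WE.
under eq_bigr => i _ do rewrite exchange_big /=.
rewrite exchange_big /=; apply: eq_bigr => a _.
under eq_bigr => i _ do rewrite exchange_big /=.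
by rewrite exchange_big.
Qed.

End Contractions.

(** * Hermitian metrics in the complex frame *)

Section HermitianGram.
Variables (R : realType) (n : nat).
Notation C := R[i].
Notation toC := (map_mx (real_complex R)).
Notation F := (frame R n).
Implicit Types G : 'M[R]_(n + n).

Lemma sqr_iC : 'i%C * 'i%C = -1 :> C.
Proof. by rewrite -expr2 sqr_i. Qed.

Lemma iC_neq0 : 'i%C != 0 :> C.
Proof.
apply/eqP => i0; have := sqr_iC; rewrite i0 mul0r => /esym/eqP.
by rewrite oppr_eq0 oner_eq0.
Qed.

(** The eigenvalues of J on the frame. *)
Definition Jdiag : 'M[C]_(n + n) := block_mx ('i%C)%:M 0 0 (- 'i%C)%:M.


Lemma frame_J : F *m toC (Jmx R n) = Jdiag *m F.
Proof.
rewrite /frame /Jmx /Jdiag map_block_mx map_mxN !map_mx0 map_mx1 !mulmx_block.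
rewrite !(mulmx0, mul0mx, add0r, addr0, mulmx1, mulmxN) -!scalar_mxM.
rewrite -!raddfN /=; congr (block_mx _%:M _%:M _%:M _%:M).
- by rewrite opprK; field.
- by rewrite mulrN mulrA sqr_iC; field.
- by field.
- by rewrite mulNr mulrA sqr_iC; field.
Qed.

Lemma frame_unit : F \in unitmx.
Proof.
(* the rows of K express d/dx and d/dy in the frame *)
pose K : 'M[C]_(n + n) := block_mx 1%:M 1%:M ('i%C)%:M (- 'i%C)%:M.
suff FK : F *m K = 1%:M by have [] := mulmx1_unit FK.
rewrite /frame /K mulmx_block !mulmx1 -!scalar_mxM -!raddfD /=.
rewrite [RHS]scalar_mx_block -(raddf0 (@scalar_mx C n)).
congr (block_mx _%:M _%:M _%:M _%:M).
- by rewrite mulNr mulrAC sqr_iC; field.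
- by rewrite mulrNN mulrAC sqr_iC; field.
- by rewrite mulrAC sqr_iC; field.
- by rewrite mulrN mulrAC sqr_iC; field.
Qed.

Lemma frame_conj j b : F (rshift n j) b = (F (lshift n j) b)^*.
Proof.
rewrite /frame; case: (split_ordP b) => k ->.
  rewrite block_mxEdl block_mxEul !mxE; case: eqP => _; rewrite ?mulr1n ?mulr0n.
    by rewrite fmorphV rmorph_nat.
  by rewrite rmorph0.
rewrite block_mxEdr block_mxEur !mxE; case: eqP => _; rewrite ?mulr1n ?mulr0n.
  rewrite rmorphN rmorphM fmorphV rmorph_nat /= -mulNr; congr (_ / _).
  by apply/eqP; rewrite eq_complex /= !opprK oppr0 !eqxx.
by rewrite rmorph0.
Qed.

(** ** Positivity *)

(** For u = a + i b, the value at u is g (a, a) + g (b, b). *)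
Lemma real_posdef G : hermitian_gram G -> posdefmx (toC G).
Proof.
case=> sG pG _; have TG : (toC G)^T = toC G by rewrite map_trmx sG.
have toCJ k l (A : 'M[R]_(k, l)) : map_mx Num.conj (toC A) = toC A.
  by apply/matrixP => i j; rewrite !mxE; exact: conjc_real.
split; first by rewrite TG toCJ.
move=> u u0.
pose a := map_mx (@complex.Re R) u; pose b := map_mx (@complex.Im R) u.
have uE : u = toC a + 'i%C *: toC b.
  by apply/rowP => i; rewrite !mxE [LHS]complexE.
have uT : u ^t* = (toC a)^T - 'i%C *: (toC b)^T.
  apply/colP => i; rewrite !mxE; case: (u 0 i) => p q.
  by apply/eqP; rewrite eq_complex /=; apply/andP; split; apply/eqP => /=; ring.
pose f (v w : 'rV[R]_(n + n)) := (v *m G *m w^T) 0 0.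
have toCf v w : toC v *m toC G *m (toC w)^T = (((f v w)%:C)%C)%:M.
  by rewrite map_trmx -!map_mxM [LHS]mx11_scalar [in LHS]mxE.
have fC : f b a = f a b.
  rewrite /f -[RHS](_ : (a *m G *m b^T)^T 0 0 = _) ?[LHS]mxE; last by rewrite mxE.
  by rewrite !trmx_mul trmxK sG mulmxA !mxE.
have -> : (u *m toC G *m u ^t*) 0 0 = ((f a a + f b b)%:C)%C.
  rewrite uT [in LHS]uE !mulmxDl !mulmxBr -!scalemxAl -!scalemxAr -?scalemxAl !scalerA sqr_iC.
  rewrite !toCf fC; move: (f a a) (f a b) (f b b) => p q r.
  rewrite rmorphD /=; move: (p%:C)%C (q%:C)%C (r%:C)%C => {}p {}q {}r.
  rewrite !scale_scalar_mx -!raddfB -!raddfD [LHS]mxE eqxx mulr1n.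
  by ring.
rewrite ltcR.
have pos0 v : 0 <= f v v.
  have [->|v0] := eqVneq v 0; first by rewrite /f !mul0mx mxE.
  exact/ltW/pG.
have [a0|a0] := eqVneq a 0; last first.
  by rewrite ltr_pwDl// pG.
rewrite ltr_pwDr// pG//; apply: contra u0 => /eqP b0.
by rewrite uE a0 b0 !map_mx0 scaler0 addr0.
Qed.

Lemma gram_det_gt0 G : hermitian_gram G -> 0 < \det G.
Proof.
move=> hG; have := posdef_det (real_posdef hG).
by rewrite det_map_mx ltcR.
Qed.

Section Blocks.
Variable G : 'M[R]_(n + n).
Hypothesis hG : hermitian_gram G.
Notation H := (frame_gram G).

Lemma gram_unit : G \in unitmx.
Proof. by rewrite unitmxE unitfE gt_eqF// gram_det_gt0. Qed.

Lemma frame_gram_unit : H \in unitmx.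
Proof.
by rewrite /frame_gram !unitmx_mul unitmx_tr frame_unit map_unitmx gram_unit.
Qed.

Lemma frame_gram_sym : H^T = H.
Proof.
have [sG _ _] := hG.
by rewrite /frame_gram !trmx_mul trmxK map_trmx sG mulmxA.
Qed.

Lemma frame_gram_J : frame_gram (Jmx R n *m G) = Jdiag *m H.
Proof. by rewrite /frame_gram map_mxM !mulmxA frame_J. Qed.

Lemma frame_gram_Jinv : Jdiag *m H *m Jdiag = H.
Proof.
have [_ _ JG] := hG.
have JGJ : Jmx R n *m G *m (Jmx R n)^T = G.
  have entry (A : 'M[R]_(n + n)) i j :
      A i j = ((delta_mx 0 i : 'rV_(n + n)) *m A *m (delta_mx 0 j : 'rV_(n + n))^T) 0 0.
    by rewrite trmx_delta -rowE -colE !mxE.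
  by apply/matrixP => i j; rewrite !entry -JG trmx_mul !mulmxA.
have JT : Jdiag^T = Jdiag.
  by rewrite /Jdiag tr_block_mx !trmx0 !tr_scalar_mx.
have -> : Jdiag *m H *m Jdiag = frame_gram (Jmx R n *m G *m (Jmx R n)^T).
  rewrite /frame_gram !map_mxM -map_trmx !mulmxA frame_J.
  by rewrite -![in RHS]mulmxA -trmx_mul frame_J trmx_mul JT !mulmxA.
by rewrite JGJ.
Qed.

(** The matrix of the metric on (1,0) x (0,1) vectors. *)
Definition hmx : 'M[C]_n := ursubmx H.

(** Compatibility with J kills the blocks on which J acts by the same eigenvalue. *)
Lemma frame_gram_block : H = block_mx 0 hmx hmx^T 0.
Proof.
have eq_opp0 (A : 'M[C]_n) : - A = A -> A = 0.
  move=> AN; apply/matrixP => i j; move/matrixP/(_ i j)/eqP: AN.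
  by rewrite !mxE eq_sym -addr_eq0 -mulr2n mulrn_eq0 => /eqP.
have gen (a b c d : 'M[C]_n) : (block_mx a b c d)^T = block_mx a b c d ->
    Jdiag *m block_mx a b c d *m Jdiag = block_mx a b c d ->
    block_mx a b c d = block_mx 0 b b^T 0.
  rewrite tr_block_mx => /eq_block_mx[_ _ <- _].
  rewrite /Jdiag !mulmx_block !(mulmx0, mul0mx, addr0, add0r).
  move=> /eq_block_mx[].
  rewrite !mul_scalar_mx !mul_mx_scalar !scalerA mulrNN sqr_iC !scaleN1r.
  by move=> /eq_opp0 -> _ _ /eq_opp0 ->.
have := gen (ulsubmx H) (ursubmx H) (dlsubmx H) (drsubmx H).
by rewrite submxK; apply; [exact: frame_gram_sym|exact: frame_gram_Jinv].
Qed.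

Lemma frame_gram_ha i j : H (lshift n i) (rshift n j) = hmx i j.
Proof. by rewrite frame_gram_block block_mxEur. Qed.

Lemma frame_gram_ah i j : H (rshift n i) (lshift n j) = hmx j i.
Proof. by rewrite frame_gram_block block_mxEdl mxE. Qed.

Lemma hmx_posdef : posdefmx hmx.
Proof.
have [GJ pG] := real_posdef hG.
pose F1 := usubmx F.
have hE : hmx = F1 *m toC G *m F1 ^t*.
  apply/matrixP => i j; rewrite -frame_gram_ha /frame_gram.
  have row_lshift (A : 'M[C]_(n + n)) k b : A (lshift n k) b = usubmx A k b.
    by rewrite mxE.
  rewrite row_lshift -!mul_usub_mx -/F1 [LHS]mxE [RHS]mxE.
  by apply: eq_bigr => b _; congr (_ * _); rewrite mxE frame_conj !mxE.
split.
  by rewrite hE !trmx_mul !map_mxM trmxCK GJ mulmxA.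
move=> u u0; rewrite hE.
have -> : u *m (F1 *m toC G *m F1 ^t*) *m u ^t* =
    (u *m F1) *m toC G *m (u *m F1) ^t*.
  by rewrite trmx_mul map_mxM !mulmxA.
apply: pG; apply: contra u0 => /eqP uF.
have : row_mx u 0 *m F = 0.
  by rewrite -[F]vsubmxK mul_row_col mul0mx addr0.
move/(congr1 (mulmx^~ (invmx F))); rewrite mulmxK ?frame_unit// mul0mx.
by move/eqP; rewrite row_mx_eq0 => /andP[].
Qed.

(** Transposed, so that the first index of [qmx] is a (1,0) index, as for [hmx]. *)
Definition qmx : 'M[C]_n := (invmx hmx)^T.

Lemma hmx_unit : hmx \in unitmx.
Proof. by rewrite unitmxE unitfE gt_eqF// posdef_det//; exact: hmx_posdef. Qed.

Lemma invmx_frame_gram : invmx H = block_mx 0 qmx qmx^T 0.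
Proof.
have E : H *m block_mx 0 qmx qmx^T 0 = 1%:M.
  rewrite frame_gram_block mulmx_block !(mulmx0, mul0mx, addr0, add0r).
  rewrite /qmx trmxK mulmxV ?hmx_unit// -trmx_mul mulVmx ?hmx_unit// trmx1.
  by rewrite -scalar_mx_block.
by rewrite -[RHS]mul1mx -(mulVmx frame_gram_unit) -mulmxA E mulmx1.
Qed.

End Blocks.
End HermitianGram.

(** * The induced endomorphism of the exterior algebra in low degree *)

Section ExtLin.
Variables (K : fieldType) (m : nat).
Implicit Types (a b : 'I_m) (alpha beta : ext K m) (A : 'M[K]_m).
Notation e_ a := (ext_basis K [set a]%SET).

Definition one_form (c : 'rV[K]_m) : ext K m := \sum_a c 0 a *: e_ a.

Lemma one_form_is_linear : linear one_form.
Proof.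
move=> k c d; rewrite /one_form scaler_sumr -big_split; apply: eq_bigr => a _ /=.
by rewrite !mxE scalerDl scalerA.
Qed.

HB.instance Definition _ := GRing.isLinear.Build K 'rV[K]_m (ext K m) *:%R
  one_form one_form_is_linear.

Lemma one_form_delta a : one_form (delta_mx 0 a) = e_ a.
Proof.
rewrite /one_form (bigD1 a)//= mxE !eqxx scale1r big1 ?addr0// => b ba.
by rewrite mxE eqxx (negPf ba) scale0r.
Qed.

Lemma one_form_inj : injective one_form.
Proof.
have coef c a : one_form c [set a]%SET = c 0 a.
  rewrite sum_ffunE (bigD1 a)//= !ffunE eqxx big1 => [|b ba].
    by rewrite addr0 /GRing.scale /= mulr1.
  by rewrite !ffunE (inj_eq set1_inj) eq_sym (negPf ba) scaler0.
by move=> c d cd; apply/rowP => a; rewrite -!coef cd.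
Qed.

Lemma wedge1r alpha : wedge alpha (ext_basis K finset.set0) = alpha.
Proof.
rewrite [in LHS](ext_basis_sum alpha) [RHS]ext_basis_sum wedge_suml.
apply: eq_bigr => S _; rewrite wedgeZl wedge_basis finset.setU0.
rewrite finset.disjoints_subset finset.setC0 finset.subsetT.
rewrite (_ : sgn K S _ = 1) ?scale1r// /sgn.
rewrite [X in pred_of_set X](_ : _ = finset.set0) ?cards0//.
by apply/setP => p; rewrite !inE andbF.
Qed.

Lemma wedge_e_e a b : (a < b)%N -> wedge (e_ a) (e_ b) = ext_basis K [set a; b]%SET.
Proof.
move=> ab; rewrite wedge_e_basis inE (_ : a == b = false); last first.
  by apply: contraTF ab => /eqP ->; rewrite ltnn.
by rewrite sgn11 ltnNge ltnW// scale1r.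
Qed.

Lemma wedge_e_eN a b : wedge (e_ a) (e_ b) = - wedge (e_ b) (e_ a).
Proof. by rewrite -[e_ a in RHS]wedge1r -[e_ b in LHS]wedge1r wedge_eN !wedge1r. Qed.

Lemma contract_e_e c a b : contract c (wedge (e_ a) (e_ b)) =
  (c == a)%:R *: e_ b - (c == b)%:R *: e_ a.
Proof.
have ce : contract c (e_ b) = (c == b)%:R *: ext_basis K finset.set0.
  by rewrite -[e_ b]wedge1r contract_wedge_e contract_basis inE wedge0r subr0.
by rewrite contract_wedge_e ce wedgeZr wedge1r.
Qed.

Lemma ext_lin_sum A (T : Type) (r : seq T) (P : pred T) (k : T -> K) (F : T -> ext K m) :
  ext_lin A (\sum_(t <- r | P t) k t *: F t) =
  \sum_(t <- r | P t) k t *: ext_lin A (F t).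
Proof.
rewrite /ext_lin; under eq_bigr => S _ do rewrite sum_ffunE scaler_suml.
rewrite exchange_big; apply: eq_bigr => t _; rewrite scaler_sumr.
by apply: eq_bigr => S _; rewrite ffunE scalerA.
Qed.

Lemma ext_lin_basis A (S : {set 'I_m}) : ext_lin A (ext_basis K S) =
  \big[@wedge K m/ext_basis K finset.set0]_(i in S) one_form (row i A).
Proof.
rewrite /ext_lin (bigD1 S)//= ffunE eqxx scale1r big1 ?addr0 => [|I IS].
  by apply: eq_bigr => i _; apply: eq_bigr => j _; rewrite mxE.
by rewrite ffunE (negPf IS) scale0r.
Qed.

Let filter_ord (S : {set 'I_m}) (s : seq 'I_m) :
  sorted (fun a b : 'I_m => (a < b)%N) s -> s =i S ->
  [seq i <- index_enum 'I_m | i \in S] = s.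
Proof.
move=> ss sS; apply: (@irr_sorted_eq _ (fun a b : 'I_m => (a < b)%N)) => //.
- by move=> a b c; apply: ltn_trans.
- by move=> a; rewrite /= ltnn.
- apply: sorted_filter; first by move=> a b c; apply: ltn_trans.
  have := iota_ltn_sorted 0 m; rewrite -val_enum_ord sorted_map.
  by rewrite enumT.
- by move=> a; rewrite mem_filter mem_index_enum andbT sS.
Qed.

Lemma ext_lin_e A a : ext_lin A (e_ a) = one_form (row a A).
Proof.
rewrite ext_lin_basis -big_filter (@filter_ord _ [:: a])//; last first.
  by move=> x; rewrite !inE.
by rewrite big_cons big_nil wedge1r.
Qed.

Lemma ext_lin_e2 A a b : (a < b)%N -> ext_lin A (wedge (e_ a) (e_ b)) =
  wedge (one_form (row a A)) (one_form (row b A)).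
Proof.
move=> ab; rewrite wedge_e_e// ext_lin_basis -big_filter.
rewrite (@filter_ord _ [:: a; b]); first by rewrite !big_cons big_nil wedge1r.
- by rewrite /= ab.
- by move=> x; rewrite !inE.
Qed.

Lemma ext_lin_one_form A c : ext_lin A (one_form c) = one_form (c *m A).
Proof.
rewrite /one_form ext_lin_sum.
under eq_bigr => a _ do rewrite ext_lin_e /one_form scaler_sumr.
rewrite exchange_big; apply: eq_bigr => b _ /=.
by rewrite !mxE scaler_suml; apply: eq_bigr => a _; rewrite mxE scalerA.
Qed.

End ExtLin.

(** * Hermitian metrics on an open set *)

Section LocalMetric.
Variables (R : realType) (n : nat).
Notation E := 'rV[R]_(n + n).
Notation C := R[i].
Variables (V : set E) (G : E -> 'M[R]_(n + n)).
Hypotheses (oV : open V) (G_smooth : forall a b, smooth_on V (fun x => G x a b)).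
Hypothesis (hG : forall x, V x -> hermitian_gram (G x)).

Notation hol := (lshift n).
Notation anti := (rshift n).
Notation e_ a := (ext_basis C [set a]%SET).
Let H y := frame_gram (G y).
Let h y := hmx (G y).
Let q y := qmx (G y).

(** ** Differentiability *)

(** The order of differentiability needed to form del (delbar Omega). *)
Definition twice_cdiff (f : E -> C) := (forall x, V x -> cdiff f x) /\
  (forall a x, V x -> cdiff (dframe a f) x).

Lemma twice_cdiff_real (u : E -> R) : smooth_on V u -> twice_cdiff (fun y => (u y)%:C%C).
Proof.
move=> su; have := su 2 => /= u2.
have du v x : V x -> derivable u x v by move=> Vx; exact: (u2 v).1.
split=> [x Vx|a x Vx]; first by apply: cdiff_real => v; exact: du.
apply: cdiff_sum => b _; apply: cdiffZ.
apply: (cdiff_germ oV Vx (f := fun y => ('D_(delta_mx 0 b) u y)%:C%C)).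
  by move=> y _; rewrite cderive_real.
by apply: cdiff_real => v; apply: ((u2 _).2 v).1.
Qed.

Lemma twice_cdiffZ k f : twice_cdiff f -> twice_cdiff (fun y => k * f y).
Proof.
move=> [df ddf]; split=> [x Vx|a x Vx]; first by apply: cdiffZ; exact: df.
apply: (cdiff_germ oV Vx (f := fun y => k * dframe a f y)).
  by move=> y Vy; rewrite dframeZ//; exact: df.
by apply: cdiffZ; exact: ddf.
Qed.

Lemma twice_cdiff_sum (T : Type) (r : seq T) (F : T -> E -> C) :
  (forall t, twice_cdiff (F t)) -> twice_cdiff (fun y => \sum_(t <- r) F t y).
Proof.
move=> dF; split=> [x Vx|a x Vx]; first by apply: cdiff_sum => t _; exact: (dF t).1.
apply: (cdiff_germ oV Vx (f := fun y => \sum_(t <- r) dframe a (F t) y)).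
  by move=> y Vy; rewrite dframe_sum// => t _; exact: (dF t).1.
by apply: cdiff_sum => t _; exact: (dF t).2.
Qed.

Lemma twice_cdiff_frame_gram a b : twice_cdiff (fun y => H y a b).
Proof.
have -> : (fun y => H y a b) = fun y => \sum_c \sum_d
    (frame R n a d * frame R n b c) * (G y d c)%:C%C.
  apply/funext => y; rewrite /H /frame_gram mxE; apply: eq_bigr => c _.
  by rewrite mxE mulr_suml; apply: eq_bigr => d _; rewrite !mxE; ring.
do 2![apply: twice_cdiff_sum => ?]; apply: twice_cdiffZ.
exact: twice_cdiff_real.
Qed.

Lemma twice_cdiff_hmx j l : twice_cdiff (fun y => h y j l).
Proof.
rewrite (_ : (fun y => h y j l) = fun y => H y (hol j) (anti l)).
  exact: twice_cdiff_frame_gram.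
by apply/funext => y; rewrite /h /hmx !mxE.
Qed.

Lemma cdiff_hmx j l x : V x -> cdiff (fun y => h y j l) x.
Proof. exact: (twice_cdiff_hmx j l).1. Qed.

Lemma cdiff_dhmx a j l x : V x -> cdiff (dframe a (fun y => h y j l)) x.
Proof. exact: (twice_cdiff_hmx j l).2. Qed.

Lemma h_unit x : V x -> h x \in unitmx.
Proof. by move=> Vx; apply: hmx_unit; exact: hG. Qed.

Let qE y i k : q y i k = invmx (h y) k i.
Proof. by rewrite /q /qmx mxE. Qed.

Lemma cdiff_qmx i k x : V x -> cdiff (fun y => q y i k) x.
Proof.
move=> Vx; under eq_fun do rewrite qE.
apply: (@cdiff_invmx _ _ _ V) => // [y Vy|j l]; first exact: h_unit.
exact: cdiff_hmx.
Qed.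

Lemma dframe_qmx a i k x : V x -> dframe a (fun y => q y i k) x =
  - \sum_j \sum_l q x j k * q x i l * dframe a (fun y => h y j l) x.
Proof.
move=> Vx; under eq_fun do rewrite qE.
rewrite (@dframe_invmx _ _ _ V)//; last 2 first.
- by move=> y Vy; exact: h_unit.
- by move=> j l; exact: cdiff_hmx.
congr (- _); apply: eq_bigr => j _; apply: eq_bigr => l _.
by rewrite !qE; ring.
Qed.

Lemma sum_hq_r i j x : V x -> \sum_l h x i l * q x j l = (i == j)%:R.
Proof.
move=> Vx; transitivity ((h x *m invmx (h x)) i j); last first.
  by rewrite mulmxV ?h_unit// mxE.
by rewrite [RHS]mxE; apply: eq_bigr => l _; rewrite qE.
Qed.

Lemma sum_hq_l k l x : V x -> \sum_i h x i l * q x i k = (k == l)%:R.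
Proof.
move=> Vx; transitivity ((invmx (h x) *m h x) k l); last first.
  by rewrite mulVmx ?h_unit// mxE.
by rewrite [RHS]mxE; apply: eq_bigr => i _; rewrite mulrC qE.
Qed.

(** ** The fundamental form *)

Definition fund_mx y : 'M[C]_(n + n) := block_mx 0 ('i%C *: h y) 0 0.

Lemma fund_form_hmx y : V y -> fund_form G y =
  \sum_j \sum_l ('i%C * h y j l) *: wedge (e_ (hol j)) (e_ (anti l)).
Proof.
move=> Vy; rewrite /fund_form big_split_ord /= [X in _ + X]big1 ?addr0; last first.
  move=> k _; rewrite big1// => b; case: (split_ordP b) => l ->.
    by rewrite ltnNge /= (leq_trans (ltnW (ltn_ord l)) (leq_addr _ _)).
  by move=> _; rewrite frame_gram_J /Jdiag frame_gram_block ?mulmx_block; 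
     [rewrite block_mxEdr !(mul0mx, mulmx0) !mxE addr0 scale0r|exact: hG].
apply: eq_bigr => j _; 
rewrite [LHS]big_mkcond [LHS]big_split_ord /= [X in X + _]big1 ?add0r; last first.
  move=> l _; case: ifP => // _; rewrite frame_gram_J /Jdiag frame_gram_block; last exact: hG.
  by rewrite mulmx_block block_mxEul !(mul0mx, mulmx0) !mxE addr0 scale0r.
apply: eq_bigr => l _; have jl : (hol j < anti l)%N.
  by rewrite /= (leq_trans (ltn_ord j)) ?leq_addr.
rewrite jl wedge_e_e// frame_gram_J /Jdiag frame_gram_block; last exact: hG.
rewrite mulmx_block block_mxEur mul0mx addr0 mul_scalar_mx.
by rewrite !mxE.
Qed.

Lemma fund_form_two_form y : V y -> fund_form G y = two_form (fund_mx y).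
Proof.
move=> Vy; rewrite fund_form_hmx// /two_form [RHS]big_split_ord /=.
rewrite [X in _ = _ + X]big1 ?addr0; last first.
  move=> k _; rewrite big1// => b _; case: (split_ordP b) => l ->.
    by rewrite /fund_mx block_mxEdl mxE scale0r.
  by rewrite /fund_mx block_mxEdr mxE scale0r.
apply: eq_bigr => j _.
rewrite [RHS]big_split_ord /= [X in _ = X + _]big1 ?add0r; last first.
  by move=> l _; rewrite /fund_mx block_mxEul mxE scale0r.
by apply: eq_bigr => l _; rewrite /fund_mx block_mxEur [in RHS]mxE.
Qed.

(** The inverse of the antisymmetrization of [fund_mx]. *)
Definition dual_mx y : 'M[C]_(n + n) :=
  block_mx 0 ('i%C *: q y) (- 'i%C *: (q y)^T) 0.

Lemma dual_mxP y : V y -> dual_mx y *m (fund_mx y - (fund_mx y)^T) = 1%:M.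
Proof.
move=> Vy; rewrite /dual_mx /fund_mx tr_block_mx opp_block_mx add_block_mx.
rewrite !trmx0 !oppr0 !(add0r, addr0) mulmx_block !(mulmx0, mul0mx, add0r, addr0).
have qh : q y *m (h y)^T = 1%:M by rewrite /q /qmx -trmx_mul mulmxV ?h_unit// trmx1.
have qh' : (q y)^T *m h y = 1%:M by rewrite /q /qmx trmxK mulVmx ?h_unit.
rewrite mulmxN linearZ /= -!scalemxAl -!scalemxAr !scalerA qh qh'.
by rewrite -scaleNr !mulNr sqr_iC opprK !scale1r -scalar_mx_block.
Qed.


(** ** Derivatives of forms *)

Lemma fderive_sum (T : finType) (alpha : E -> ext C (n + n)) (f : T -> E -> C)
    (w : T -> ext C (n + n)) a x : V x ->
  (forall y, V y -> alpha y = \sum_t f t y *: w t) ->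
  (forall t, cdiff (f t) x) ->
  fderive a alpha x = \sum_t dframe a (f t) x *: w t.
Proof.
move=> Vx aE df; apply/ffunP => S; rewrite fderiveE.
rewrite (@dframe_germ _ _ V a _ (fun y => \sum_t w t S * f t y))//; last first.
  move=> y Vy; rewrite aE// sum_ffunE; apply: eq_bigr => t _.
  by rewrite ffunE mulrC.
rewrite dframe_sum => [|t _]; last exact: cdiffZ.
rewrite sum_ffunE; apply: eq_bigr => t _.
by rewrite dframeZ// ffunE mulrC.
Qed.

Let dh a j l := dframe a (fun y => h y j l).

Lemma fderive_fund_form a x : V x -> fderive a (fund_form G) x =
  \sum_j \sum_l ('i%C * dh a j l x) *: wedge (e_ (hol j)) (e_ (anti l)).
Proof.
move=> Vx; rewrite pair_bigA /=.
rewrite (@fderive_sum _ _ (fun t y => 'i%C * h y t.1 t.2)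
  (fun t => wedge (e_ (hol t.1)) (e_ (anti t.2))))//.
- by apply: eq_bigr => t _; rewrite dframeZ//; exact: cdiff_hmx.
- by move=> y Vy; rewrite fund_form_hmx// pair_bigA.
- by move=> t; apply: cdiffZ; exact: cdiff_hmx.
Qed.

Lemma delbar_fund_form x : V x -> delbar (fund_form G) x =
  \sum_k \sum_j \sum_l ('i%C * dh (anti k) j l x) *:
    wedge (e_ (anti k)) (wedge (e_ (hol j)) (e_ (anti l))).
Proof.
move=> Vx; apply: eq_bigr => k _; rewrite fderive_fund_form// wedge_sumr.
apply: eq_bigr => j _; rewrite wedge_sumr; apply: eq_bigr => l _.
by rewrite wedgeZr.
Qed.

Let ddh i k j l := dframe (hol i) (dh (anti k) j l).

Lemma del_delbar_fund_form x : V x -> del (delbar (fund_form G)) x =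
  \sum_i \sum_k \sum_j \sum_l ('i%C * ddh i k j l x) *:
    wedge (e_ (hol i))
      (wedge (e_ (anti k)) (wedge (e_ (hol j)) (e_ (anti l)))).
Proof.
move=> Vx; apply: eq_bigr => i _.
transitivity (wedge (e_ (hol i)) (\sum_k \sum_j \sum_l ('i%C * ddh i k j l x) *:
    wedge (e_ (anti k)) (wedge (e_ (hol j)) (e_ (anti l))))); last first.
  do 3![rewrite wedge_sumr; apply: eq_bigr => ? _].
  by rewrite wedgeZr.
congr (wedge _ _); under eq_bigr => k _ do rewrite pair_bigA.
rewrite pair_bigA /=.
rewrite (@fderive_sum _ _ (fun t y => 'i%C * dh (anti t.1) t.2.1 t.2.2 y)
  (fun t => wedge (e_ (anti t.1)) (wedge (e_ (hol t.2.1)) (e_ (anti t.2.2)))))//.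
- by apply: eq_bigr => t _; rewrite dframeZ//; exact: cdiff_dhmx.
- move=> y Vy; rewrite delbar_fund_form//.
  under eq_bigr => k _ do rewrite pair_bigA.
  by rewrite pair_bigA.
- by move=> t; apply: cdiffZ; exact: cdiff_dhmx.
Qed.

(** ** The first Gauduchon condition *)

(** Of the three pairings in [wedge4_pow], the one that pairs dz_i with dz_j is
    zero. *)
Lemma wedge4_fund i k j l x : (2 <= n)%N -> V x ->
  (n * n.-1)%:R *: wedge (wedge (e_ (hol i))
      (wedge (e_ (anti k)) (wedge (e_ (hol j)) (e_ (anti l)))))
    (wedge_pow (fund_form G x) (n - 2)) =
  (q x i l * q x j k - q x i k * q x j l) *: wedge_pow (fund_form G x) n.
Proof.
move=> n2 Vx; rewrite fund_form_two_form// -!wedgeA.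
rewrite (@wedge4_pow_sub2 _ _ _ (dual_mx x)) ?dual_mxP//.
rewrite /dual_mx !block_mxEdl !block_mxEur block_mxEdr; congr (_ *: _).
have -> (a : C) r s : (a *: q x) r s = a * q x r s by rewrite mxE.
rewrite ![(_ *: (q x)^T) _ _]mxE ![(q x)^T _ _]mxE [(0 : 'M[C]_n) _ _]mxE.
rewrite mul0r subr0.
by have := sqr_iC R; move: ('i%C) => z zz; ring: zz.
Qed.

Lemma gauduchon_trace x : (2 <= n)%N -> V x ->
  wedge (del (delbar (fund_form G)) x) (wedge_pow (fund_form G x) (n - 2)) = 0 ->
  \sum_i \sum_k \sum_j \sum_l
    q x i k * q x j l * (ddh i k j l x - ddh i l j k x) = 0.
Proof.
move=> n2 Vx; rewrite del_delbar_fund_form// => gau.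
have : (\sum_i \sum_k \sum_j \sum_l ('i%C * ddh i k j l x) *
    (q x i l * q x j k - q x i k * q x j l)) *: wedge_pow (fund_form G x) n = 0.
  rewrite -[RHS](scaler0 _ (n * n.-1)%:R) -gau.
  do 4![rewrite wedge_suml scaler_sumr scaler_suml; apply: eq_bigr => ? _].
  by rewrite wedgeZl [RHS]scalerA [X in _ = X *: _]mulrC -[RHS]scalerA wedge4_fund// scalerA.
move/eqP; rewrite scaler_eq0 [in X in _ || X]fund_form_two_form//.
rewrite (negPf (pow_top_neq0 (dual_mxP Vx))) orbF => /eqP S0.
have i_neq0 : - 'i%C != 0 :> C.
  by rewrite oppr_eq0 iC_neq0.
apply: (mulfI i_neq0); rewrite mulr0 -[RHS]S0; apply/esym.
exact: (@sum_antisym4 _ _ (q x) (fun i k j l => ddh i k j l x)).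
Qed.


(** ** The Lee form *)

Let tau a x := \sum_j \sum_l q x j l * dh a j l x.

Lemma vol_density_neq0 x : V x -> vol_density G x != 0.
Proof.
move=> Vx; have dG := gram_det_gt0 (hG Vx).
by rewrite /vol_density -(rmorph0 (real_complex R)) (inj_eq (@complexI R)) gt_eqF// sqrtr_gt0.
Qed.

Lemma cdiff_vol_density x : V x -> cdiff (vol_density G) x.
Proof.
move=> Vx; apply: cdiff_real => v.
have dG : derivable (fun y => \det (G y)) x v.
  have dGC : cdiff (fun y => \det (map_mx (real_complex R) (G y))) x.
    apply: cdiff_det => i j; under eq_fun do rewrite mxE.
    exact: (twice_cdiff_real (G_smooth i j)).1.
  have <- : (fun y => complex.Re (\det (map_mx (real_complex R) (G y)))) =
      fun y => \det (G y) by apply/funext => y; rewrite det_map_mx.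
  exact: (cdiff_parts dGC v).1.
have d0 : 0 < \det (G x) by exact/gram_det_gt0/hG.
pose f (t : R) := \det (G (t *: v + x)).
have df : differentiable f 0.
  by apply/derivable1_diffP; exact: (derivable1P (fun y => \det (G y)) x v).1 dG.
have ds : differentiable Num.sqrt (f 0).
  apply/derivable1_diffP; rewrite /f scale0r add0r.
  by have [] := is_derive1_sqrt d0.
apply: (derivable1P (fun y => Num.sqrt (\det (G y))) x v).2.
by apply/derivable1_diffP; exact: (differentiable_comp df ds).
Qed.

(** The square of the density is a constant multiple of the determinant in the
    frame, so that Jacobi's formula applies. *)
Lemma dframe_vol_density a x : V x ->
  dframe a (vol_density G) x = vol_density G x * tau a x.
Proof.
move=> Vx; have Hu y : V y -> H y \in unitmx by move=> Vy; exact/frame_gram_unit/hG.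
pose k := \det (frame R n) * \det (frame R n).
have k0 : k != 0.
  by rewrite mulf_neq0//; have := frame_unit R n; rewrite unitmxE unitfE.
have detH y : V y -> \det (H y) = k * (vol_density G y * vol_density G y).
  move=> Vy; rewrite /H /frame_gram !det_mulmx det_tr det_map_mx /vol_density.
  rewrite -rmorphM -expr2 sqr_sqrtr ?ltW ?gram_det_gt0//; last exact: hG.
  by rewrite /k; ring.
have dv := cdiff_vol_density Vx.
have dH i j : cdiff (fun y => H y i j) x by exact: (twice_cdiff_frame_gram i j).1.
have := @dframe_germ _ _ V a _ _ x oV Vx detH.
rewrite dframeZ; last exact: cdiffM.
rewrite dframeM// dframe_det_unit//; last exact: Hu.
rewrite (detH _ Vx).
have -> : \sum_i \sum_j invmx (H x) j i * dframe a (fun y => H y i j) x = 2 * tau a x.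
  have dHh i j : dframe a (fun y => H y (hol i) (anti j)) x = dh a i j x.
    by apply: (dframe_germ a oV Vx) => y Vy; rewrite /H frame_gram_ha//; exact: hG.
  have dHah i j : dframe a (fun y => H y (anti i) (hol j)) x = dh a j i x.
    by apply: (dframe_germ a oV Vx) => y Vy; rewrite /H frame_gram_ah//; exact: hG.
  rewrite big_split_ord /=.
  have invH : invmx (H x) = block_mx 0 (q x) (q x)^T 0 by exact/invmx_frame_gram/hG.
  have -> : \sum_i \sum_j invmx (H x) j (hol i) * dframe a (fun y => H y (hol i) j) x =
      tau a x.
    apply: eq_bigr => i _; rewrite big_split_ord /= big1 ?add0r => [|j _].
      by apply: eq_bigr => j _; rewrite dHh invH block_mxEdl mxE.
    by rewrite invH block_mxEul mxE mul0r.
  have -> : \sum_i \sum_j invmx (H x) j (anti i) * dframe a (fun y => H y (anti i) j) x =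
      tau a x.
    rewrite /tau [RHS]exchange_big; apply: eq_bigr => i _.
    rewrite big_split_ord /= [X in _ + X]big1 ?addr0 => [|j _].
      by apply: eq_bigr => j _; rewrite dHah invH block_mxEur.
    by rewrite invH block_mxEdr mxE mul0r.
  by rewrite mulr2n mulrDl mul1r.
have v0 := vol_density_neq0 Vx.
move: (vol_density G x) v0 (dframe a (vol_density G) x) (tau a x) => r r0 dr t.
move=> E; clearbody k.
have kr0 : k * r * 2 != 0 by rewrite !mulf_eq0 (negPf k0) (negPf r0) pnatr_eq0.
apply: (mulfI kr0); transitivity (k * (dr * r + r * dr)); first by ring.
by rewrite -E; ring.
Qed.


(** Raising both indices of i h gives -i q, by q h q = q. *)
Lemma raise_fund_form y : V y -> raise G (fund_form G) y =
  \sum_i \sum_k (- 'i%C * q y i k) *: wedge (e_ (hol i)) (e_ (anti k)).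
Proof.
move=> Vy; rewrite /raise fund_form_hmx// pair_bigA ext_lin_sum /=.
have invH : invmx (frame_gram (G y)) = block_mx 0 (q y) (q y)^T 0.
  exact/invmx_frame_gram/hG.
have row_hol j : one_form (row (hol j) (invmx (frame_gram (G y)))) =
    \sum_k q y j k *: e_ (anti k).
  rewrite /one_form [LHS]big_split_ord /= [X in X + _]big1 ?add0r => [|k _].
    by apply: eq_bigr => k _; rewrite mxE invH block_mxEur.
  by rewrite mxE invH block_mxEul mxE scale0r.
have row_anti l : one_form (row (anti l) (invmx (frame_gram (G y)))) =
    \sum_i q y i l *: e_ (hol i).
  rewrite /one_form big_split_ord /= [X in _ + X]big1 ?addr0 => [|k _].
    by apply: eq_bigr => k _; rewrite mxE invH block_mxEdl mxE.
  by rewrite mxE invH block_mxEdr mxE scale0r.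
have lt (j l : 'I_n) : (hol j < anti l)%N by rewrite /= (leq_trans (ltn_ord j)) ?leq_addr.
transitivity (\sum_j \sum_l \sum_i \sum_k
    (- 'i%C * h y j l * q y j k * q y i l) *: wedge (e_ (hol i)) (e_ (anti k))).
  rewrite [RHS]pair_bigA; apply: eq_bigr => -[j l] _ /=.
  rewrite ext_lin_e2// row_hol row_anti exchange_big wedge_suml scaler_sumr.
  apply: eq_bigr => k _; rewrite wedgeZl wedge_sumr !scaler_sumr.
  apply: eq_bigr => i _; rewrite wedgeZr wedge_e_eN !scalerN !scalerA -scaleNr.
  by congr (_ *: _); ring.
under [LHS]eq_bigr => j _ do rewrite exchange_big /=.
rewrite [LHS]exchange_big; apply: eq_bigr => i _ /=.
under [LHS]eq_bigr => j _ do rewrite exchange_big /=.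
rewrite [LHS]exchange_big; apply: eq_bigr => k _ /=.
under eq_bigr => j _ do rewrite -scaler_suml.
rewrite -scaler_suml; congr (_ *: _).
transitivity (\sum_j - 'i%C * q y j k * \sum_l h y j l * q y i l).
  apply: eq_bigr => j _; rewrite mulr_sumr; apply: eq_bigr => l _.
  by ring.
rewrite (bigD1 i)//= sum_hq_r// eqxx mulr1 big1 ?addr0// => j ji.
by rewrite sum_hq_r// (negPf ji) mulr0.
Qed.

(** The one-form inside [codiff] has the divergences below among its coefficients;
    lowering its index and applying J are injective on one-forms. *)
Lemma lee_form_divergence x : V x -> lee_form G x = 0 ->
  forall i, \sum_k dframe (anti k) (fun y => vol_density G y * q y i k) x = 0.
Proof.
move=> Vx lee0.
pose r i k a := - 'i%C * dframe a (fun y => vol_density G y * q y i k) x.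
have dr i k : cdiff (fun y => vol_density G y * q y i k) x.
  by apply: cdiffM; [exact: cdiff_vol_density|exact: cdiff_qmx].
pose c : 'rV[C]_(n + n) := \sum_i \sum_k (r i k (hol i) *: delta_mx 0 (anti k) -
  r i k (anti k) *: delta_mx 0 (hol i)).
have etaE : \sum_a contract a (fderive a
    (fun y => vol_density G y *: raise G (fund_form G) y) x) = one_form c.
  have fd a : fderive a (fun y => vol_density G y *: raise G (fund_form G) y) x =
      \sum_i \sum_k r i k a *: wedge (e_ (hol i)) (e_ (anti k)).
    rewrite pair_bigA /= (@fderive_sum _ _
      (fun t y => - 'i%C * (vol_density G y * q y t.1 t.2))
      (fun t => wedge (e_ (hol t.1)) (e_ (anti t.2))))//.
    - by apply: eq_bigr => t _; rewrite dframeZ.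
    - move=> y Vy; rewrite raise_fund_form// pair_bigA scaler_sumr.
      by apply: eq_bigr => t _; rewrite scalerA mulrCA.
    - by move=> t; exact: cdiffZ.
  under eq_bigr => a _.
    rewrite fd contract_sum; under eq_bigr => i _ do rewrite contract_sum.
    over.
  rewrite exchange_big linear_sum; apply: eq_bigr => i _ /=.
  rewrite exchange_big linear_sum; apply: eq_bigr => k _ /=.
  rewrite linearB !linearZ /= !one_form_delta scalerN.
  under eq_bigr => a _ do rewrite contractZ contract_e_e scalerBr.
  rewrite sumrB; congr (_ - _).
    rewrite (bigD1 (hol i))//= eqxx scale1r big1 ?addr0// => a ai.
    by rewrite (negPf ai) scale0r scaler0.
  rewrite (bigD1 (anti k))//= eqxx scale1r big1 ?addr0// => a ak.
  by rewrite (negPf ak) scale0r scaler0.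
move: lee0; rewrite /lee_form /Jform /codiff /lower etaE -linearZ /=.
rewrite !ext_lin_one_form -(linear0 (@one_form _ _)) => /one_form_inj.
set JM := block_mx _ _ _ _ => c0.
have JMu : JM *m Jdiag R n = 1%:M.
  rewrite /JM /Jdiag mulmx_block !(mulmx0, mul0mx, addr0, add0r) -!scalar_mxM.
  by rewrite mulNr mulrN sqr_iC opprK -scalar_mx_block.
have {c0} c0 : c = 0.
  move: c0 => /(congr1 (mulmx^~ (Jdiag R n))); rewrite mul0mx -(mulmxA _ JM) JMu mulmx1.
  move=> /(congr1 (mulmx^~ (invmx (frame_gram (G x))))).
  rewrite mul0mx mulmxK; last exact/frame_gram_unit/hG.
  move=> /eqP; rewrite scaler_eq0 oppr_eq0 invr_eq0 (negPf (vol_density_neq0 Vx)) /=.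
  by move/eqP.
move=> i; have cE : c 0 (hol i) =
    'i%C * \sum_k dframe (anti k) (fun y => vol_density G y * q y i k) x.
  rewrite /c summxE (bigD1 i)//= [X in _ + X]big1 ?addr0 => [|j ji].
    rewrite summxE mulr_sumr; apply: eq_bigr => k _; rewrite !mxE eqxx /=.
    by rewrite eq_lrshift eqxx /r mulr0 mulr1 sub0r mulNr opprK.
  rewrite summxE big1// => k _; rewrite !mxE eqxx /= eq_lrshift.
  by rewrite (inj_eq (@lshift_inj _ _)) eq_sym (negPf ji) !mulr0 subr0.
apply: (mulfI (iC_neq0 R)); rewrite -cE c0 mulr0.
by rewrite mxE.
Qed.

(** Expand the divergence with [dframe_vol_density] and [dframe_qmx], divide by the
    volume density, and lower the free index by h. *)
Lemma lee_form_trace x : V x -> lee_form G x = 0 -> forall l,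
  \sum_j \sum_m q x j m * (dh (anti l) j m x - dh (anti m) j l x) = 0.
Proof.
move=> Vx /(lee_form_divergence Vx) div l.
have v0 := vol_density_neq0 Vx.
have div' i : \sum_k (tau (anti k) x * q x i k -
    \sum_p \sum_s q x p k * q x i s * dh (anti k) p s x) = 0.
  apply: (mulfI v0); rewrite mulr0 -[RHS](div i) mulr_sumr.
  apply: eq_bigr => k _; rewrite dframeM; last 2 first.
  - exact: cdiff_vol_density.
  - exact: cdiff_qmx.
  by rewrite dframe_vol_density// dframe_qmx// /dh; ring.
transitivity (\sum_i h x i l * \sum_k (tau (anti k) x * q x i k -
    \sum_p \sum_s q x p k * q x i s * dh (anti k) p s x)); last first.
  by rewrite big1// => i _; rewrite div' mulr0.
under [RHS]eq_bigr => i _ do rewrite mulr_sumr.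
rewrite [RHS]exchange_big /=.
transitivity (\sum_k ((k == l)%:R * tau (anti k) x -
    \sum_p q x p k * dh (anti k) p l x)).
  rewrite sumrB [in RHS](bigD1 l)//= eqxx mul1r [X in _ = _ + X - _]big1; last first.
    by move=> k kl; rewrite (negPf kl) mul0r.
  rewrite addr0 /tau [X in _ = _ - X]exchange_big -sumrB; apply: eq_bigr => j _.
  by rewrite -sumrB; apply: eq_bigr => m _; rewrite mulrBr.
apply: eq_bigr => k _.
under [RHS]eq_bigr => i _ do rewrite mulrBr.
rewrite sumrB; congr (_ - _).
  rewrite -(sum_hq_l k l Vx) mulr_suml; apply: eq_bigr => i _.
  by rewrite mulrA mulrAC.
transitivity (\sum_p \sum_s q x p k * dh (anti k) p s x * \sum_i h x i l * q x i s).
  apply: eq_bigr => p _; rewrite (bigD1 l)//= sum_hq_l// eqxx mulr1 big1 ?addr0// => s sl.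
  by rewrite sum_hq_l// (negPf sl) mulr0.
under [RHS]eq_bigr => i _ do rewrite mulr_sumr.
rewrite [RHS]exchange_big; apply: eq_bigr => p _ /=.
under [RHS]eq_bigr => i _ do rewrite mulr_sumr.
rewrite [RHS]exchange_big; apply: eq_bigr => s _ /=.
rewrite mulr_sumr; apply: eq_bigr => i _.
by move: (dh _ _ _ _) => D; ring.
Qed.


(** ** Vanishing of the torsion *)

Lemma conj_hmx y i j : V y -> (h y i j)^* = h y j i.
Proof.
move=> Vy; have hh : (h y) ^t* = h y by have [] := hmx_posdef (hG Vy).
by rewrite -[in RHS]hh [RHS]mxE [X in _ = _ X]mxE.
Qed.

(** Conjugation exchanges d/dz with d/dzb, and h is Hermitian. *)
Lemma conj_dh k i j x : V x -> (dh (hol k) i j x)^* = dh (anti k) j i x.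
Proof.
move=> Vx; rewrite rmorph_sum; apply: eq_bigr => b _; rewrite rmorphM /=.
rewrite -frame_conj; congr (_ * _).
transitivity (cderive (delta_mx 0 b) (fun y => (h y i j)^*%C) x).
  by apply/esym/cderiveJ; exact: cdiff_hmx.
by apply: (cderive_germ oV Vx) => y Vy; exact: conj_hmx.
Qed.

Let T k l j x := dh (hol k) l j x - dh (hol l) k j x.
Let S k l j x := dh (anti k) j l x - dh (anti l) j k x.

(** The identity behind the proof is [dtrace]: it is the derivative along d_i of the
    vanishing trace of S, and it turns the second-order Gauduchon condition into a
    quadratic condition on first derivatives. *)
Lemma torsion_eq0 x : (2 <= n)%N -> V x ->
  (forall y, V y -> lee_form G y = 0) ->
  wedge (del (delbar (fund_form G)) x) (wedge_pow (fund_form G x) (n - 2)) = 0 ->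
  forall k l j, T k l j x = 0.
Proof.
move=> n2 Vx lee0 gau.
have TJ k l j : (T k l j x)^* = S k l j x by rewrite rmorphB /= !conj_dh.
have cS k l j : cdiff (S k l j) x by apply: cdiffB; exact: cdiff_dhmx.
have dS i k l j : dframe (hol i) (S k l j) x = ddh i k j l x - ddh i l j k x.
  by rewrite dframeB//; exact: cdiff_dhmx.
have dtrace i k : \sum_j \sum_l q x j l * (ddh i k j l x - ddh i l j k x) =
    \sum_a \sum_l q x a l * \sum_j \sum_b q x j b * (S k l j x * dh (hol i) a b x).
  have d0 : \sum_j \sum_l (dframe (hol i) (fun y => q y j l) x * S k l j x +
      q x j l * dframe (hol i) (S k l j) x) = 0.
    rewrite -[RHS](dframe_cst (hol i) 0 x).
    rewrite -(@dframe_germ _ _ V (hol i)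
      (fun y => \sum_j \sum_l q y j l * S k l j y) (fun=> 0) x oV Vx); last first.
      by move=> y Vy; apply: lee_form_trace => //; exact: lee0.
    have dqS j l : cdiff (fun y => q y j l * S k l j y) x.
      by apply: cdiffM => //; exact: cdiff_qmx.
    rewrite dframe_sum => [|j _]; last exact: cdiff_sum.
    apply: eq_bigr => j _; rewrite dframe_sum//; apply: eq_bigr => l _.
    by rewrite dframeM//; exact: cdiff_qmx.
  transitivity (\sum_j \sum_l \sum_a \sum_b
      q x a l * (q x j b * (S k l j x * dh (hol i) a b x))).
    apply/eqP; rewrite -subr_eq0 -[X in _ == X]d0 -sumrB; apply/eqP.
    apply: eq_bigr => j _; rewrite -sumrB; apply: eq_bigr => l _.
    rewrite dS dframe_qmx// addrC; congr (_ + _).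
    rewrite mulNr mulr_suml; congr (- _); apply: eq_bigr => a _.
    rewrite mulr_suml; apply: eq_bigr => b _.
    by rewrite -/(dh (hol i) a b x); move: (S _ _ _ _) (dh _ _ _ _) => ? ?; ring.
  under eq_bigr => j _ do rewrite exchange_big /=.
  rewrite exchange_big; apply: eq_bigr => a _ /=.
  rewrite exchange_big; apply: eq_bigr => l _ /=.
  rewrite mulr_sumr; apply: eq_bigr => j _.
  by rewrite mulr_sumr.
apply: (@posdef_tensor _ _ (h x) (q x) (fun k l j => T k l j x)).
- exact/hmx_posdef/hG.
- apply/matrixP => i j; rewrite [LHS]mxE [RHS]mxE -(sum_hq_r i j Vx).
  by apply: eq_bigr => l _; rewrite [X in _ * X]mxE.
transitivity (\sum_i \sum_k q x i k * \sum_a \sum_l q x a l * \sum_j \sum_b q x j b *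
    (S k l j x * (dh (hol i) a b x - dh (hol a) i b x))).
  apply: eq_bigr => i _; apply: eq_bigr => k _; congr (_ * _).
  apply: eq_bigr => a _; apply: eq_bigr => l _; congr (_ * _).
  by apply: eq_bigr => j _; apply: eq_bigr => b _; rewrite TJ.
apply: (@sum_antisym6 _ _ (q x) (fun k l j => S k l j x)
  (fun i a b => dh (hol i) a b x)).
  by move=> k l j; rewrite /S opprB.
rewrite -[RHS](gauduchon_trace n2 Vx gau).
apply: eq_bigr => i _; apply: eq_bigr => k _; rewrite -dtrace mulr_sumr.
apply: eq_bigr => j _; rewrite mulr_sumr; apply: eq_bigr => l _.
by rewrite mulrA.
Qed.

Lemma antisym_sum0 (W : lmodType C) (D : 'I_n -> 'I_n -> C) (w : 'I_n -> 'I_n -> W) :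
  (forall i j, D i j = D j i) -> (forall i j, w i j = - w j i) ->
  \sum_i \sum_j D i j *: w i j = 0.
Proof.
move=> sD aw; set X := \sum_i _.
have XN : X = - X.
  rewrite {1}/X exchange_big -sumrN; apply: eq_bigr => i _; rewrite -sumrN.
  by apply: eq_bigr => j _; rewrite sD aw scalerN.
apply/eqP; have /eqP : 2%:R *: X = 0 by rewrite scaler_nat mulr2n {1}XN addNr.
by rewrite scaler_eq0 pnatr_eq0.
Qed.

(** dOmega is a combination of the dz_i dz_j dzb_l and the dzb_k dz_j dzb_l, whose
    coefficients are symmetric in (i, j), resp. (k, l), when the torsion is zero. *)
Theorem local_kahler x : (2 <= n)%N -> V x ->
  (forall y, V y -> lee_form G y = 0) ->
  wedge (del (delbar (fund_form G)) x) (wedge_pow (fund_form G x) (n - 2)) = 0 ->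
  extd (fund_form G) x = 0.
Proof.
move=> n2 Vx lee0 gau; have T0 := torsion_eq0 n2 Vx lee0 gau.
have hol_sym k l j : dh (hol k) l j x = dh (hol l) k j x.
  by apply/eqP; rewrite -subr_eq0 -/(T k l j x) T0.
have anti_sym k l j : dh (anti k) j l x = dh (anti l) j k x.
  by rewrite -!conj_dh// hol_sym.
rewrite /extd big_split_ord /=.
have -> : \sum_i wedge (e_ (hol i)) (fderive (hol i) (fund_form G) x) = 0.
  transitivity (\sum_l \sum_i \sum_j ('i%C * dh (hol i) j l x) *:
      wedge (e_ (hol i)) (wedge (e_ (hol j)) (e_ (anti l)))).
    rewrite exchange_big; apply: eq_bigr => i _; rewrite fderive_fund_form//.
    rewrite wedge_sumr exchange_big; apply: eq_bigr => j _; rewrite wedge_sumr.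
    by apply: eq_bigr => l _; rewrite wedgeZr.
  apply: big1 => l _; apply: antisym_sum0 => i j; first by rewrite hol_sym.
  exact: wedge_eN.
rewrite add0r.
transitivity (\sum_j \sum_k \sum_l ('i%C * dh (anti k) j l x) *:
    wedge (e_ (anti k)) (wedge (e_ (hol j)) (e_ (anti l)))).
  rewrite exchange_big; apply: eq_bigr => k _; rewrite fderive_fund_form//.
  rewrite wedge_sumr; apply: eq_bigr => j _; rewrite wedge_sumr.
  by apply: eq_bigr => l _; rewrite wedgeZr.
apply: big1 => j _; apply: antisym_sum0 => k l; first by rewrite anti_sym.
rewrite wedge_eN [in RHS]wedge_eN; congr (- _).
by rewrite wedge_e_eN wedgeNr.
Qed.

End LocalMetric.

Theorem proposition2p4 (R : realType) (n : nat) (M : topologicalType)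
    (X : complex_atlas R n M) (g : hermitian_metric X) :
  (3 <= n)%N -> hausdorff_space M -> compact [set: M]%classic ->
  first_gauduchon g -> balanced g -> kahler g.
Proof.
move=> n3 _ _ gau bal i x ix; apply: (local_kahler (V := codom i)) => //.
- exact: codom_open.
- exact: gram_smooth.
- by move=> y; exact: gram_hermitian.
- exact: ltnW.
- exact: bal.
- exact: gau.
Qed.
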